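(* Let $(M,\tau)$ be a tracial $W^*$-probability space and $D\subset M$ a unital $*$-subalgebra with $\dim(D)<\infty$. Consider two unital $*$-subalgebras $A_1,A_2\subset M$, algebraically free (over $\mathbb C$), with $D\subset A_2$ (but $D$ not assumed to be contained in $A_1$). If $j_{\mathbb C}(A_1:A_2)$ exists, then $j_D(A_1\vee D:A_2)$ exists, too, and is given by $$j_D(A_1\vee D:A_2)=E_{D'}\bigl(j_{\mathbb C}(A_1:A_2)\bigr)\cdot c^{-1}\cdot\dim(D).$$
   Context: A tracial $W^*$-probability space $(M,\tau)$ is a von Neumann algebra $M$ with a faithful normal trace (tracial state) $\tau$. $L^2(S_1,\dots,S_p)$ is the closure, in $\|a\|_{L^2}^2=\tau(aa^* )$, of the von Neumann algebra generated by the $S_i$. $A_1\vee A_2$ is the algebra generated by $A_1$ and $A_2$. Liberation gradient: let $C\subset M$ be a unital $*$-subalgebra with $\tau$-preserving conditional expectation $E_C:M\to C$ (unital $C$-bimodule linear map, extended to $L^2(M,\tau)$), and let $C\subset A_1,A_2\subset M$ be subalgebras that are algebraically free modulo $C$ (the canonical map $A_1*_CA_2\to A=A_1\vee A_2$ is injective). $\delta_{A_1:A_2}:A\to A\otimes_CA$ is the derivation with $\delta_{A_1:A_2}(a)=a\otimes1-1\otimes a$ for $a\in A_1$ and $=0$ for $a\in A_2$. $j_C(A_1:A_2)$ is the vector $j\in L^2(A_1,A_2)$ (if it exists) with $E_C(ja)=(E_C\otimes E_C)(\delta_{A_1:A_2}(a))$ for all $a\in A$, where $(E_C\otimes E_C)(a\otimes\hat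 a)=E_C(a)E_C(\hat a)$. For $C=\mathbb C$, $E_{\mathbb C}=\tau$; for $C=D$, $E_D$ is the $\tau$-preserving conditional expectation onto $D$. Let $D\cong M_{n_1}(\mathbb C)\oplus\dots\oplus M_{n_k}(\mathbb C)$ with minimal central projections $p_1,\dots,p_k$; then $c=(n_1^2+\dots+n_k^2)\sum_{j=1}^k\frac{\tau(p_j)}{n_j^2}p_j\in D$. $E_{D'}(\xi)=\int_Uu\xi u^*\,du$ for $\xi\in L^2(M,\tau)$, where $U$ is the compact group of unitaries of $D$ and $du$ its normalized Haar measure. *)

(* Defs.v *)
From HB Require Import structures.
From mathcomp Require Import all_boot all_order all_algebra.
From mathcomp Require Import sesquilinear spectral complex.
From mathcomp Require Import all_classical all_reals all_analysis.

Set Implicit Arguments.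
Unset Strict Implicit.
Unset Printing Implicit Defensive.

Import Order.TTheory GRing.Theory Num.Theory.
Import numFieldNormedType.Exports.

Local Open Scope classical_set_scope.
Local Open Scope complex_scope.
Local Open Scope ring_scope.

Record hilbertSpace (R : realType) := HilbertSpace {
  hilbert_carrier :> completeNormedModType R[i];
  (* linear in the first variable, antilinear in the second one *)
  dot : {dot hilbert_carrier for @Num.conj R[i]};
  dot_norm : forall u, `|u| ^+ 2 = dot u u
}.

Definition commutant (R : realType) (H : hilbertSpace R) (S : set (H -> H)) :
    set (H -> H) :=
  [set T | [/\ linear T, continuous T & forall s, S s -> T \o s = s \o T]].

(* A tracial W*-probability space (M, tau).  The algebra M is given together
   with a faithful unital *-representation [wrep] identifying it with a von
   Neumann algebra of bounded operators, that is, with its own bicommutant.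
   M is a [unitAlgType] only so that the library notation x^-1 is available:
   for the units of M it denotes the two-sided inverse. *)
Record tracialSpace (R : realType) := TracialSpace {
  tracial_alg :> unitAlgType R[i];
  star : tracial_alg -> tracial_alg;
  starK : involutive star;
  star_antilinear : forall (k : R[i]) x y,
    star (k *: x + y) = k^* *: star x + star y;
  starM : forall x y, star (x * y) = star y * star x;
  wrep_space : hilbertSpace R;
  wrep : tracial_alg -> wrep_space -> wrep_space;
  wrep_linear : forall x, linear (wrep x);
  wrep_continuous : forall x, continuous (wrep x);
  wrep_inj : injective wrep;
  wrepD : forall (k : R[i]) x y v, wrep (k *: x + y) v = k *: wrep x v + wrep y v;
  wrep1 : forall v, wrep 1 v = v;
  wrepM : forall x y v, wrep (x * y) v = wrep x (wrep y v);
  wrep_star : forall x u v, dot _ (wrep x u) v = dot _ u (wrep (star x) v);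
  wrep_bicommutant : commutant (commutant (range wrep)) = range wrep;
  trace : {scalar tracial_alg};
  trace1 : trace 1 = 1;
  trace_ge0 : forall x, 0 <= trace (star x * x);
  trace_faithful : forall x, trace (star x * x) = 0 -> x = 0;
  traceC : forall x y, trace (x * y) = trace (y * x);
  (* normality: trace (sup S) = sup trace(S) for every upward directed set S of
     positive elements having a supremum in M *)
  trace_normal :
    let pos := [set z | exists y, z = star y * y] in
    let le := fun x y => pos (y - x) in
    forall (S : set tracial_alg) (x : tracial_alg),
      S !=set0 -> S `<=` pos ->
      (forall s t, S s -> S t -> exists r, [/\ S r, le s r & le t r]) ->
      (forall s, S s -> le s x) ->
      (forall y, (forall s, S s -> le s y) -> le x y) ->
      forall t : R[i], (forall s, S s -> trace s <= t) -> trace x <= t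
}.
Arguments star {R} _.
Arguments trace {R} _.
Arguments wrep {R} _.

Section Subalgebras.
Variables (R : realType) (M : tracialSpace R).
Implicit Types (A S : set M).

Definition unital_subalgebra A :=
  [/\ A 1, forall (k : R[i]) x y, A x -> A y -> A (k *: x + y)
    & forall x y, A x -> A y -> A (x * y)].

Definition unital_star_subalgebra A :=
  unital_subalgebra A /\ forall x, A x -> A (star M x).

Record starSubalg := StarSubalg {
  star_subalg_set :> set M;
  star_subalgP : unital_star_subalgebra star_subalg_set
}.

Definition vn_subalgebra A :=
  unital_star_subalgebra A /\
  commutant (commutant (wrep M @` A)) = wrep M @` A.

(* A1 \/ A2 *)
Definition alg_join A1 A2 : set M := smallest unital_subalgebra (A1 `|` A2).

Definition vn_generated S : set M := smallest vn_subalgebra S.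

Lemma star0 : star M 0 = 0.
Proof.
have /eqP := star_antilinear (1 : R[i]) (0 : M) 0.
by rewrite scale1r addr0 rmorph1 scale1r -subr_eq subrr eq_sym => /eqP.
Qed.

Lemma star1 : star M 1 = 1.
Proof. by rewrite -[LHS]mul1r -{1}[1](starK (t := M)) -starM mul1r starK. Qed.

Lemma scalars_subproof :
  unital_star_subalgebra [set x : M | exists k : R[i], x = k%:A].
Proof.
split; first split.
- by exists 1; rewrite scale1r.
- by move=> k _ _ [a ->] [b ->]; exists (k * a + b); rewrite scalerDl scalerA.
- by move=> _ _ [a ->] [b ->]; exists (a * b);
    rewrite -scalerAl mul1r scalerA.
- move=> _ [a ->]; exists (a^*).
  by rewrite -[a *: 1]addr0 star_antilinear star0 addr0 star1.
Qed.

Definition scalars : starSubalg := StarSubalg scalars_subproof.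

Definition has_dim (A : set M) (d : nat) :=
  exists b : 'I_d -> M,
    (forall x : 'I_d -> R[i], \sum_i x i *: b i = 0 -> forall i, x i = 0) /\
    A = [set \sum_i x i *: b i | x in [set: 'I_d -> R[i]]].

Definition hom_on (B : algType R[i]) A (f : M -> B) :=
  [/\ f 1 = 1,
      forall (k : R[i]) x y, A x -> A y -> f (k *: x + y) = k *: f x + f y
    & forall x y, A x -> A y -> f (x * y) = f x * f y].

(* (P, i1, i2) is the amalgamated free product A1 *_C A2, i.e. the pushout of
   C -> A1 and C -> A2 in unital algebras; only the values of i1 on A1 and of
   i2 on A2 matter. *)
Definition amalgamated_free_product (C A1 A2 : set M) (P : algType R[i])
    (i1 i2 : M -> P) :=
  [/\ hom_on A1 i1, hom_on A2 i2, {in C, i1 =1 i2}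
    & forall (B : algType R[i]) (f1 f2 : M -> B),
        hom_on A1 f1 -> hom_on A2 f2 -> {in C, f1 =1 f2} ->
        exists f : {lrmorphism P -> B},
          [/\ {in A1, f \o i1 =1 f1}, {in A2, f \o i2 =1 f2}
            & forall g : {lrmorphism P -> B},
                {in A1, g \o i1 =1 f1} -> {in A2, g \o i2 =1 f2} -> g =1 f]].

(* The morphism f below is the canonical map A1 *_C A2 -> A1 \/ A2. *)
Definition alg_free_mod (C A1 A2 : set M) :=
  exists (P : algType R[i]) (i1 i2 : M -> P),
    amalgamated_free_product C A1 A2 i1 i2 /\
    exists f : {lrmorphism P -> M},
      [/\ {in A1, f \o i1 =1 id}, {in A2, f \o i2 =1 id} & injective f].

(* Elements of A (x)_C A are represented by formal sums of elementary tensors,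
   the sequence [:: (x1, y1); ...; (xn, yn)] standing for
   x1 (x) y1 + ... + xn (x) yn.  [tens_eq C A] is equality in A (x)_C A: the
   congruence generated by commutativity of the sum, biadditivity and
   C-balancedness (hence, if C contains the scalars, C-linearity). *)
Inductive tens_eq (C A : set M) : seq (M * M) -> seq (M * M) -> Prop :=
| tens_refl s : tens_eq C A s s
| tens_sym s t : tens_eq C A s t -> tens_eq C A t s
| tens_trans s t r : tens_eq C A s t -> tens_eq C A t r -> tens_eq C A s r
| tens_cat s s' t t' : tens_eq C A s s' -> tens_eq C A t t' ->
    tens_eq C A (s ++ t) (s' ++ t')
| tens_comm s t : tens_eq C A (s ++ t) (t ++ s)
| tens_addl x x' y : A x -> A x' -> A y ->
    tens_eq C A [:: (x + x', y)] [:: (x, y); (x', y)]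
| tens_addr x y y' : A x -> A y -> A y' ->
    tens_eq C A [:: (x, y + y')] [:: (x, y); (x, y')]
| tens_0l y : A y -> tens_eq C A [:: (0, y)] [::]
| tens_0r x : A x -> tens_eq C A [:: (x, 0)] [::]
| tens_bal x c y : A x -> C c -> A y ->
    tens_eq C A [:: (x * c, y)] [:: (x, c * y)].

Definition tens_lmul (a : M) (s : seq (M * M)) := [seq (a * p.1, p.2) | p <- s].
Definition tens_rmul (s : seq (M * M)) (a : M) := [seq (p.1, p.2 * a) | p <- s].

Definition derivation (C A : set M) (delta : M -> seq (M * M)) :=
  [/\ forall a, A a -> forall p, p \in delta a -> A p.1 /\ A p.2,
      forall (k : R[i]) a b, A a -> A b ->
        tens_eq C A (delta (k *: a + b)) (tens_lmul k%:A (delta a) ++ delta b)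
    & forall a b, A a -> A b ->
        tens_eq C A (delta (a * b))
                    (tens_lmul a (delta b) ++ tens_rmul (delta a) b)].

Definition liberation_derivation (C A1 A2 : set M) (delta : M -> seq (M * M)) :=
  let A := alg_join A1 A2 in
  [/\ derivation C A delta,
      forall a, A1 a -> tens_eq C A (delta a) [:: (a, 1); (-1, a)]
    & forall a, A2 a -> tens_eq C A (delta a) [::]].

Definition conditional_expectation (C : set M) (E : M -> M) :=
  [/\ linear E, forall x, C (E x), E 1 = 1,
      forall c x c', C c -> C c' -> E (c * x * c') = c * E x * c'
    & forall x, trace M (E x) = trace M x].

End Subalgebras.

(* The completion of M for the norm tau(a a^* )^(1/2), together with the
   (unique) continuous extensions of left and right multiplication by
   elements of M. *)
Record l2Space (R : realType) (M : tracialSpace R) := L2Space {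
  l2_space :> hilbertSpace R;
  l2_in : {linear M -> l2_space};
  l2_dot : forall a b, dot _ (l2_in a) (l2_in b) = trace M (a * star M b);
  l2_dense : dense (range l2_in);
  l2_lmul : M -> l2_space -> l2_space;
  l2_lmul_linear : forall a, linear (l2_lmul a);
  l2_lmul_continuous : forall a, continuous (l2_lmul a);
  l2_lmulE : forall a x, l2_lmul a (l2_in x) = l2_in (a * x);
  l2_rmul : l2_space -> M -> l2_space;
  l2_rmul_linear : forall a, linear (l2_rmul ^~ a);
  l2_rmul_continuous : forall a, continuous (l2_rmul ^~ a);
  l2_rmulE : forall a x, l2_rmul (l2_in x) a = l2_in (x * a)
}.
Arguments l2_in {R M} _.
Arguments l2_lmul {R M} _.
Arguments l2_rmul {R M} _.

Section LiberationGradient.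
Variables (R : realType) (M : tracialSpace R) (L : l2Space M).

Definition l2_generated (S : set M) : set L :=
  closure (l2_in L @` vn_generated S).

(* E is the conditional expectation E_C : M -> C and Ehat its continuous
   extension to L^2(M, tau). *)
Definition l2_conditional_expectation (C : set M) (E : M -> M) (Ehat : L -> L) :=
  [/\ conditional_expectation C E, linear Ehat, continuous Ehat
    & forall x, Ehat (l2_in L x) = l2_in L (E x)].

(* j = j_C(A1 : A2); (E_C (x) E_C)(x (x) y) = E_C(x) E_C(y) *)
Definition is_liberation_gradient (C : starSubalg M) (A1 A2 : set M) (j : L) :=
  [/\ unital_subalgebra A1 /\ unital_subalgebra A2,
      C `<=` A1 /\ C `<=` A2, alg_free_mod C A1 A2,
      l2_generated (A1 `|` A2) j
    & exists (E : M -> M) (Ehat : L -> L) (delta : M -> seq (M * M)),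
      [/\ l2_conditional_expectation C E Ehat,
          liberation_derivation C A1 A2 delta
        & forall a, alg_join A1 A2 a ->
            Ehat (l2_rmul L j a) =
            l2_in L (\sum_(p <- delta a) E p.1 * E p.2)]].

End LiberationGradient.

Section UnitaryGroup.
Variables (R : realType) (M : tracialSpace R) (D : starSubalg M).

Definition is_unitary_in (u : M) :=
  [/\ (D : set M) u, star M u * u = 1 & u * star M u = 1].

Definition unitary : Type := {u : M | `[< is_unitary_in u >]}.

HB.instance Definition _ := Choice.on unitary.

Lemma unitary1_subproof : `[< is_unitary_in 1 >].
Proof.
by apply/asboolP; split; rewrite ?star1 ?mulr1 //; case: (star_subalgP D) => -[].
Qed.

HB.instance Definition _ := isPointed.Build unitary (exist _ 1 unitary1_subproof).

Lemma unitaryM_subproof (u v : unitary) : `[< is_unitary_in (val u * val v) >].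
Proof.
case: u v => u /= /asboolP[Du uu uu'] [v /= /asboolP[Dv vv vv']].
apply/asboolP; case: (star_subalgP D) => -[_ _ DM] _; split; first exact: DM.
- by rewrite starM mulrA -(mulrA (star M v)) uu mulr1.
- by rewrite starM mulrA -(mulrA u) vv' mulr1.
Qed.

Definition unitary_mul (u v : unitary) : unitary :=
  exist _ (val u * val v) (unitaryM_subproof u v).

Variable L : l2Space M.

(* D being finite-dimensional, all the usual topologies agree on its unitary
   group; this is the one induced by the norm of L^2(M, tau). *)
Definition unitary_topology := initial_topology (l2_in L \o val : unitary -> L).

Definition unitary_borel := g_sigma_algebraType (@open unitary_topology).

Definition is_haar (mu : probability unitary_borel R) :=
  forall (u : unitary) (B : set unitary_borel), measurable B ->
    mu (unitary_mul u @^-1` B) = mu B.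

Definition Cintegral (mu : probability unitary_borel R) (f : unitary -> R[i]) :
    R[i] :=
  (\int[mu]_(u in setT) complex.Re (f u)) +i* (\int[mu]_(u in setT) complex.Im (f u)).

(* E_{D'}(xi), the integral of u xi u^* du as a weak integral in L^2(M, tau) *)
Definition unitary_average (mu : probability unitary_borel R) (xi : L) : L :=
  xget 0 [set e : L | forall eta : L,
    dot L e eta =
    Cintegral mu (fun u =>
      dot L (l2_lmul L (val u) (l2_rmul L xi (star M (val u)))) eta)].

End UnitaryGroup.

Local Open Scope sesquilinear_scope.

(* A *-isomorphism of M_{n_1}(C) + ... + M_{n_k}(C) onto D *)
Record blockIso (R : realType) (M : tracialSpace R) (D : set M)
    (k : nat) (n : 'I_k -> nat) := BlockIso {
  block_map :> (forall j, 'M[R[i]]_(n j)) -> M;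
  block_size_gt0 : forall j, (0 < n j)%N;
  block_linear : forall (a : R[i]) (X Y : forall j, 'M[R[i]]_(n j)),
    block_map (fun j => a *: X j + Y j) = a *: block_map X + block_map Y;
  block_mul : forall X Y : (forall j, 'M[R[i]]_(n j)),
    block_map (fun j => X j *m Y j) = block_map X * block_map Y;
  block_one : block_map (fun j => 1%:M) = 1;
  block_star : forall X : (forall j, 'M[R[i]]_(n j)),
    block_map (fun j => (X j)^t*) = star M (block_map X);
  block_inj : injective block_map;
  block_range : range block_map = D
}.

Section BlockIso.
Variables (R : realType) (M : tracialSpace R) (D : set M).
Variables (k : nat) (n : 'I_k -> nat) (phi : blockIso D n).

(* The minimal central projections of D are the units of its blocks. *)
Definition central_proj (j : 'I_k) : M := phi (fun i => ((i == j)%:R)%:M).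

Definition liberation_c : M :=
  ((\sum_j n j ^ 2)%N)%:R *:
  \sum_j (trace M (central_proj j) / (n j ^ 2)%:R) *: central_proj j.

End BlockIso.

(* Main.v *)
Require Import Defs.
From mathcomp Require Import all_boot all_order all_algebra complex.
From mathcomp Require Import all_classical all_reals all_analysis.
From mathcomp Require Import sesquilinear measurable_realfun ring.
Import Order.TTheory GRing.Theory Num.Theory.
Import numFieldNormedType.Exports.
Local Open Scope classical_set_scope.
Local Open Scope complex_scope.
Local Open Scope ring_scope.

(** Write [e_pq] for the matrix units of [D], [m_p] for the size of the block of
    [p] and [w_p = tau(e_pp)]; the [e_pq] are orthogonal in L^2 with
    [tau(e_pq e_pq^* ) = w_p], so [E_D(x) = \sum tau(x e_qp) / w_p e_pq].
    Schur orthogonality for the matrix coefficients of the unitary group gives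
    [E_{D'}(xi) = \sum 1/m_p e_pq xi e_qp]; invariance of the Haar measure is only
    needed for the reflections [1 - 2 e_pp] and for the unitaries that swap two
    basis vectors of a block.

    In [A (x)_D A] both [a (x) 1 - 1 (x) a] and 0 agree on [D], so the given
    derivation also serves as the one for [A1 \/ D] and [A2] over [D].  It
    vanishes on [D], so moving all factors from [D] onto [a] by traciality yields,
    for [j' = dim(D) E_{D'}(j) c^-1] and [delta(a) = \sum x (x) y],
      [<j' a b, 1> = \sum \sum_pq dim(D)/m_p tau(e_qp c^-1 x) tau(y b e_pq)].
    Since [e_qp c^-1 = m_p / (dim(D) w_p) e_qp], this is
    [\sum tau(E_D(x) E_D(y) b)]. *)

Set Implicit Arguments.
Unset Strict Implicit.

(** * Maps given with a linearity predicate *)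

Section LinearPredicate.
Variables (K : pzRingType) (U V : lmodType K) (f : U -> V).
Hypothesis f_linear : linear f.

Lemma linear_predD x y : f (x + y) = f x + f y.
Proof. by have := f_linear 1 x y; rewrite !scale1r. Qed.

Lemma linear_pred0 : f 0 = 0.
Proof. by have /eqP := linear_predD 0 0; rewrite addr0 -subr_eq subrr eq_sym => /eqP. Qed.

Lemma linear_predZ a x : f (a *: x) = a *: f x.
Proof. by have := f_linear a x 0; rewrite linear_pred0 !addr0. Qed.

Lemma linear_pred_sum (J : Type) (r : seq J) (P : pred J) (F : J -> U) :
  f (\sum_(i <- r | P i) F i) = \sum_(i <- r | P i) f (F i).
Proof. exact: (big_morph f linear_predD linear_pred0). Qed.
End LinearPredicate.

(** * Inner products: Cauchy-Schwarz inequality and continuity *)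

Section Hilbert.
Variables (R : realType) (H : hilbertSpace R).
Implicit Types u v w : H.

Lemma dot_CauchySchwarz u v : `|dot H u v| <= `|u| * `|v|.
Proof.
have [->|v0] := eqVneq v 0; first by rewrite linear0r normr0 normr0 mulr0.
rewrite -(@ler_pXn2r _ 2) ?nnegrE ?mulr_ge0 // exprMn !dot_norm.
have vv0 : dot H v v != 0 by rewrite dnorm_eq0.
(* Pythagoras for [u], split into its projection [a *: v] and the orthogonal rest [w]. *)
pose a := dot H u v / dot H v v; pose w := u - a *: v.
have wv : dot H w v = 0.
  by rewrite linearBl /= linearZl_LR /= divfK ?subrr.
have -> : u = w + a *: v by rewrite subrK.
rewrite linearDl /= wv add0r linearZl_LR /= normrM hnormDd /=; last first.
  by rewrite linearZr_LR /= wv mulr0.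
rewrite dnormZ mulrDl exprMn -[X in _ <= _ + X]mulrA.
by rewrite (ger0_norm (dnorm_ge0 _ v)) -expr2 lerDr mulr_ge0.
Qed.

Lemma dot_continuousl v : continuous (fun u : H => dot H u v : (R[i])^o).
Proof.
move=> u; apply/(@cvgrPdist_lt _ (R[i])^o) => e e0.
near=> w; rewrite -linearBl /=.
apply: (le_lt_trans (dot_CauchySchwarz _ _)).
(* The added 1 keeps the later divisor positive when [v] is 0. *)
apply: (@le_lt_trans _ _ (`|u - w| * (`|v| + 1))).
  by rewrite ler_wpM2l // lerDl.
rewrite -ltr_pdivlMr ?ltr_wpDl //.
near: w; apply: (@cvgr_dist_lt _ _ _ (nbhs u) _ id u) => //.
by rewrite divr_gt0 // ltr_wpDl.
Unshelve. all: by end_near. Qed.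

Lemma dot_lincomb (J : finType) (c : J -> R[i]) (u : J -> H) v :
  dot H (\sum_i c i *: u i) v = \sum_i c i * dot H (u i) v.
Proof.
have fl : linear (fun u : H => dot H u v : (R[i])^o).
  by move=> k x y; rewrite linearDl linearZl_LR.
by rewrite (linear_pred_sum fl); under eq_bigr do rewrite (linear_predZ fl).
Qed.

Lemma dot_inj u v : (forall w, dot H u w = dot H v w) -> u = v.
Proof.
move=> uv; apply/eqP; rewrite -subr_eq0 -(dnorm_eq0 (dot H)).
by rewrite linearBl /= uv subrr.
Qed.

End Hilbert.

Lemma continuous_compose (T U V : topologicalType) (f : T -> U) (g : U -> V) :
  continuous f -> continuous g -> continuous (g \o f).
Proof. by move=> cf cg x; apply: continuous_comp; [exact: cf | exact: cg]. Qed.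

Lemma continuous_sum (K : numFieldType) (T : topologicalType) (V : normedModType K)
    (J : Type) (r : seq J) (F : J -> T -> V) :
  (forall i, continuous (F i)) -> continuous (fun x => \sum_(i <- r) F i x).
Proof.
move=> cF; elim: r => [|i r IH].
  have -> : (fun x => \sum_(i <- [::]) F i x) = cst 0.
    by apply/funext => y; rewrite big_nil.
  by move=> x; exact: cvg_cst.
have -> : (fun x => \sum_(i <- i :: r) F i x) =
    (fun x => F i x + \sum_(i <- r) F i x).
  by apply/funext => y; rewrite big_cons.
by move=> x; apply: cvgD; [exact: cF | exact: IH].
Qed.

(** * L^2(M, tau) as a bimodule over M *)

Section L2.
Variables (R : realType) (M : tracialSpace R) (L : l2Space M).
Implicit Types (a b x : M) (xi eta : L).

(** Preimages of neighbourhoods of [f xi] and [g xi] meet the dense image of [M] in a point where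
    the two maps agree, and Hausdorffness does the rest. This reduces identities in L^2 to
    identities in [M]. *)
Lemma l2_dense_eq (T : topologicalType) (f g : L -> T) : hausdorff_space T ->
  continuous f -> continuous g ->
  (forall x, f (l2_in L x) = g (l2_in L x)) -> f =1 g.
Proof.
move=> hT cf cg fg xi; apply: hT => A B fA gB.
have : nbhs xi (f @^-1` A `&` g @^-1` B) by apply: filterI; [apply: cf | apply: cg].
rewrite nbhsE => -[U [oU Uxi] UAB].
have [|y [Uy [x _ xE]]] := @l2_dense _ _ L U _ oU; first by exists xi.
have [Afy Bgy] := UAB _ Uy; exists (f y); split=> //.
by move: Bgy; rewrite /= -xE fg.
Qed.

(** The structure supplies linearity in the vector only; linearity in the element of [M] follows by
    density. *)
Lemma l2_lmulD k a b xi :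
  l2_lmul L (k *: a + b) xi = k *: l2_lmul L a xi + l2_lmul L b xi.
Proof.
move: xi; apply: l2_dense_eq.
- exact: norm_hausdorff.
- exact: l2_lmul_continuous.
- move=> xi; apply: cvgD; last exact: l2_lmul_continuous.
  by apply: cvgZl_tmp; exact: l2_lmul_continuous.
- by move=> x; rewrite !l2_lmulE -linearP mulrDl -scalerAl.
Qed.

Lemma l2_lmul0 xi : l2_lmul L 0 xi = 0.
Proof. exact: (linear_pred0 (fun k a b => l2_lmulD k a b xi)). Qed.

Lemma l2_rmulD k a b xi :
  l2_rmul L xi (k *: a + b) = k *: l2_rmul L xi a + l2_rmul L xi b.
Proof.
move: xi; apply: l2_dense_eq.
- exact: norm_hausdorff.
- exact: l2_rmul_continuous.
- move=> xi; apply: cvgD; last exact: l2_rmul_continuous.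
  by apply: cvgZl_tmp; exact: l2_rmul_continuous.
- by move=> x; rewrite !l2_rmulE -linearP mulrDr -scalerAr.
Qed.

Lemma l2_dot_rmul xi a b :
  dot L (l2_rmul L xi a) (l2_in L b) = dot L xi (l2_in L (b * star M a)).
Proof.
move: xi; apply: l2_dense_eq.
- exact: (@norm_hausdorff _ (R[i])^o).
- exact: continuous_compose (@l2_rmul_continuous _ _ L a) (@dot_continuousl _ L _).
- exact: dot_continuousl.
- by move=> x; rewrite l2_rmulE !l2_dot starM starK mulrA.
Qed.

(** Unlike its analogue for right multiplication, this adjoint relation rests on traciality, the
    inner product being tau(x y^* ). *)
Lemma l2_dot_lmul xi a b :
  dot L (l2_lmul L a xi) (l2_in L b) = dot L xi (l2_in L (star M a * b)).
Proof.
move: xi; apply: l2_dense_eq.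
- exact: (@norm_hausdorff _ (R[i])^o).
- exact: continuous_compose (@l2_lmul_continuous _ _ L a) (@dot_continuousl _ L _).
- exact: dot_continuousl.
- by move=> x; rewrite l2_lmulE !l2_dot starM starK -mulrA traceC -mulrA.
Qed.

Lemma l2_lmul_sum (J : finType) (c : J -> R[i]) (a : J -> M) xi :
  l2_lmul L (\sum_i c i *: a i) xi = \sum_i c i *: l2_lmul L (a i) xi.
Proof.
have fl : linear (fun a : M => l2_lmul L a xi) by move=> k x y; exact: l2_lmulD.
by rewrite (linear_pred_sum fl); under eq_bigr do rewrite (linear_predZ fl).
Qed.

Lemma l2_rmul_sum (J : finType) (c : J -> R[i]) (a : J -> M) xi :
  l2_rmul L xi (\sum_i c i *: a i) = \sum_i c i *: l2_rmul L xi (a i).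
Proof.
have fl : linear (fun a : M => l2_rmul L xi a) by move=> k x y; exact: l2_rmulD.
by rewrite (linear_pred_sum fl); under eq_bigr do rewrite (linear_predZ fl).
Qed.

End L2.

(** * Matrix units and the orthogonal projection onto their span *)

Record matrix_units (R : realType) (M : tracialSpace R) (D : set M)
    (I J : finType) (t : I -> J) (e : I * I -> M) : Prop := MatrixUnits {
  munit_off : forall p q, t p != t q -> e (p, q) = 0;
  munit_mul : forall p q r s,
    e (p, q) * e (r, s) = ((q == r) && (t p == t q))%:R *: e (p, s);
  munit_star : forall p q, star M (e (p, q)) = e (q, p);
  munit_one : \sum_p e (p, p) = 1;
  munit_neq0 : forall p, e (p, p) != 0;
  munit_span : D = [set \sum_i y i *: e i | y in [set: I * I -> R[i]]]
}.

Section MatrixUnits.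
Variables (R : realType) (M : tracialSpace R) (D : set M).
Variables (I J : finType) (t : I -> J) (e : I * I -> M).
Hypothesis eP : matrix_units D t e.

Lemma star_linear_sum (c : I * I -> R[i]) :
  star M (\sum_i c i *: e i) = \sum_i (c i)^* *: star M (e i).
Proof.
have starD : {morph star M : x y / x + y}.
  by move=> x y; have := star_antilinear (1 : R[i]) x y; rewrite rmorph1 !scale1r.
rewrite (big_morph _ starD (star0 M)); apply: eq_bigr => i _.
by have := star_antilinear (c i) (e i) 0; rewrite star0 !addr0.
Qed.

Definition mweight (p : I) : R[i] := trace M (e (p, p)).

Lemma mweight_gt0 p : 0 < mweight p.
Proof.
have ee : star M (e (p, p)) * e (p, p) = e (p, p).
  by rewrite (munit_star eP) (munit_mul eP) !eqxx scale1r.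
rewrite lt_neqAle eq_sym; apply/andP; split; last by rewrite /mweight -ee trace_ge0.
by apply: contra_neq (munit_neq0 eP p) => /= w0; apply: trace_faithful; rewrite ee.
Qed.

Lemma mweight_neq0 p : mweight p != 0.
Proof. by rewrite gt_eqF ?mweight_gt0. Qed.

(** Traciality applied to [e_pq e_qp = e_pp] and [e_qp e_pq = e_qq]. *)
Lemma mweight_class p q : t p = t q -> mweight p = mweight q.
Proof.
move=> tpq; have := traceC (e (p, q)) (e (q, p)).
by rewrite !(munit_mul eP) tpq !eqxx !scale1r.
Qed.

Lemma trace_munit p q : trace M (e (p, q)) = (p == q)%:R * mweight p.
Proof.
have [<-|pq] := eqVneq p q; first by rewrite mul1r.
(* For [p != q] the product [e_pp e_pq] is [e_pq], while [e_pq e_pp] is 0. *)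
rewrite mul0r; have := traceC (e (p, p)) (e (p, q)).
by rewrite !(munit_mul eP) eq_sym (negbTE pq) !eqxx /= scale1r scale0r linear0.
Qed.

Lemma trace_munitM p q r s : trace M (e (p, q) * e (r, s)) =
  [&& q == r, p == s & t p == t q]%:R * mweight p.
Proof.
rewrite (munit_mul eP) linearZ /= trace_munit mulrA.
by case: (q == r); case: (p == s); case: (t p == t q) => /=; rewrite ?mul1r ?mul0r.
Qed.

Lemma trace_munit_star i j : trace M (e i * star M (e j)) =
  ((i == j) && (t i.1 == t i.2))%:R * mweight i.1.
Proof.
case: i j => [p q] [r s]; rewrite (munit_star eP) trace_munitM xpair_eqE /=.
by case: (q == s); case: (p == r).
Qed.

(** Fourier coefficient for the orthogonal family [e]. The family is indexed by all pairs, so that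
    sums run over one finite type; at a pair from two different blocks the unit, and with it the
    coefficient, is 0. *)
Definition mcoef (z : M) (i : I * I) : R[i] :=
  trace M (z * star M (e i)) / mweight i.1.

(** The orthogonal projection onto [D], which is the trace-preserving conditional expectation
    [E_D]. *)
Definition mexp (z : M) : M := \sum_i mcoef z i *: e i.

Lemma mexp_linear : linear mexp.
Proof.
move=> k x y; rewrite /mexp scaler_sumr -big_split; apply: eq_bigr => i _ /=.
by rewrite /mcoef mulrDl linearD /= -scalerAl linearZ /= scalerA -scalerDl mulrA mulrDl.
Qed.

Lemma munit_in i : D (e i).
Proof.
rewrite (munit_span eP); exists (fun j => (j == i)%:R) => //.
rewrite (bigD1 i) //= eqxx scale1r big1 ?addr0 // => j /negbTE->.
by rewrite scale0r.
Qed.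

Lemma mexp_in z : D (mexp z).
Proof. by rewrite (munit_span eP); exists (mcoef z). Qed.

Lemma mexp_id z : D z -> mexp z = z.
Proof.
rewrite {1}(munit_span eP) => -[y _ <-]; apply: eq_bigr => i _.
(* In the given expansion the coefficient at an off-block pair is arbitrary, but it multiplies 0. *)
case ti: (t i.1 == t i.2); last first.
  by case: i ti => p q /negbT /= /(munit_off eP) ->; rewrite !scaler0.
congr (_ *: _); rewrite /mcoef mulr_suml linear_sum /= (bigD1 i) //= big1.
  by rewrite addr0 -scalerAl linearZ /= trace_munit_star eqxx ti mul1r mulfK ?mweight_neq0.
by move=> j /negbTE ji; rewrite -scalerAl linearZ /= trace_munit_star ji mul0r mulr0.
Qed.

Lemma trace_mexp_munit z i : trace M (mexp z * star M (e i)) = trace M (z * star M (e i)).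
Proof.
case ti: (t i.1 == t i.2); last first.
  case: i ti => p q /negbT /= /(munit_off eP) ->.
  by rewrite star0 !mulr0.
rewrite /mexp mulr_suml linear_sum /= (bigD1 i) //= big1.
  rewrite addr0 -scalerAl linearZ /= trace_munit_star eqxx ti mul1r.
  by rewrite divfK ?mweight_neq0.
by move=> j /negbTE ji; rewrite -scalerAl linearZ /= trace_munit_star ji mul0r mulr0.
Qed.

Lemma trace_mexp z b : D b -> trace M (mexp z * b) = trace M (z * b).
Proof.
rewrite (munit_span eP) => -[y _ <-]; rewrite !mulr_sumr !linear_sum /=.
apply: eq_bigr => -[p q] _; rewrite -!scalerAr !linearZ /=; congr (_ * _).
by rewrite -(munit_star eP) trace_mexp_munit.
Qed.

(** An element of [D] equals its own expansion, whose coefficients are traces against matrix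
    units. *)
Lemma mexp_unique z w : D w -> (forall b, D b -> trace M (w * b) = trace M (z * b)) ->
  w = mexp z.
Proof.
move=> Dw wz; rewrite -[LHS](mexp_id Dw); apply: eq_bigr => -[p q] _.
by rewrite /mcoef (munit_star eP) wz //; exact: munit_in.
Qed.

End MatrixUnits.

(** * The conditional expectation onto D and its extension to L^2 *)

Section MatrixUnitExpectation.
Variables (R : realType) (M : tracialSpace R) (L : l2Space M) (D : set M).
Variables (I J : finType) (t : I -> J) (e : I * I -> M).
Hypothesis eP : matrix_units D t e.
Hypothesis D_subalg : unital_subalgebra D.

Lemma mexp_conditional : conditional_expectation D (mexp e).
Proof.
have [D1 _ DM] := D_subalg; split.
- exact: mexp_linear.
- exact: mexp_in eP.
- exact: mexp_id eP _ D1.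
(* Bimodularity by uniqueness: under the trace against [b], the factor [c] is cycled round, so that
   [x] is paired with [c' * b * c] in [D]. *)
- move=> c x c' Dc Dc'; apply/esym/(mexp_unique eP).
    by apply: (DM _ _ _ Dc') => //; apply: DM => //; exact: mexp_in eP _.
  move=> b Db; rewrite -!mulrA [LHS]traceC [RHS]traceC -!mulrA.
  by rewrite (trace_mexp eP) //; do !apply: (DM).
- by move=> x; have := trace_mexp eP x D1; rewrite !mulr1.
Qed.

(** A finite Fourier expansion makes sense for every vector, so the continuous extension of [E_D]
    has an explicit formula. *)
Definition l2_mexp (xi : L) : L :=
  \sum_i (dot L xi (l2_in L (e i)) / mweight e i.1) *: l2_in L (e i).

Lemma l2_mexp_linear : linear l2_mexp.
Proof.
move=> k x y; rewrite /l2_mexp scaler_sumr -big_split; apply: eq_bigr => i _ /=.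
by rewrite linearDl linearZl_LR /= scalerA -scalerDl mulrA mulrDl.
Qed.

Lemma l2_mexpE z : l2_mexp (l2_in L z) = l2_in L (mexp e z).
Proof.
by rewrite /mexp linear_sum; apply: eq_bigr => i _; rewrite linearZ l2_dot.
Qed.

Lemma l2_mexp_continuous : continuous l2_mexp.
Proof.
apply: (@continuous_sum _ L L) => i xi; apply: cvgZr_tmp; apply: cvgMr_tmp.
exact: dot_continuousl.
Qed.

Lemma l2_mexp_conditional : l2_conditional_expectation D (mexp e) l2_mexp.
Proof.
split; first exact: mexp_conditional.
- exact: l2_mexp_linear.
- exact: l2_mexp_continuous.
- exact: l2_mexpE.
Qed.

(** The pairing with [star M b] stands for tau(xi b), the inner product being antilinear on the
    right. These numbers contain all coefficients of the expansion of [xi]. *)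
Lemma l2_mexp_unique xi z : D z ->
  (forall b, D b -> dot L xi (l2_in L (star M b)) = trace M (z * b)) ->
  l2_mexp xi = l2_in L z.
Proof.
move=> Dz xz; rewrite -[in RHS](mexp_id eP Dz) linear_sum; apply: eq_bigr => -[p q] _.
by rewrite linearZ /mcoef (munit_star eP) -xz ?(munit_star eP) //; exact: munit_in eP _.
Qed.

End MatrixUnitExpectation.

(** * Unital subalgebras and their joins *)

Section UnitalSubalgebra.
Variables (R : realType) (M : tracialSpace R).
Implicit Types (A B : set M).

Lemma subalg0 A : unital_subalgebra A -> A 0.
Proof.
by move=> [A1 AL _]; have := AL (-1) _ _ A1 A1; rewrite scaleN1r addNr.
Qed.

Lemma subalgZ A k x : unital_subalgebra A -> A x -> A (k *: x).
Proof.
by move=> sA Ax; have [_ AL _] := sA; have := AL k _ _ Ax (subalg0 sA); rewrite addr0.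
Qed.

Lemma subalgD A x y : unital_subalgebra A -> A x -> A y -> A (x + y).
Proof. by move=> [_ AL _] Ax Ay; have := AL 1 _ _ Ax Ay; rewrite scale1r. Qed.

Lemma subalgN A x : unital_subalgebra A -> A x -> A (- x).
Proof. by move=> sA Ax; rewrite -scaleN1r; exact: subalgZ. Qed.

Lemma subalg_sum A (J : Type) (r : seq J) (F : J -> M) : unital_subalgebra A ->
  (forall i, A (F i)) -> A (\sum_(i <- r) F i).
Proof.
move=> sA AF; elim: r => [|i r IH]; first by rewrite big_nil; exact: subalg0.
by rewrite big_cons; exact: subalgD.
Qed.

Lemma alg_join_subalg A B : unital_subalgebra (alg_join A B).
Proof.
split.
- by move=> C [[C1 _ _] _].
- by move=> k x y Ax Ay C CP; have [[_ CL _] _] := CP; apply: CL; [exact: Ax | exact: Ay].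
- by move=> x y Ax Ay C CP; have [[_ _ CM] _] := CP; apply: CM; [exact: Ax | exact: Ay].
Qed.

Lemma alg_join_subl A B : A `<=` alg_join A B.
Proof. by move=> x Ax C [_ sC]; apply: sC; left. Qed.

Lemma alg_join_subr A B : B `<=` alg_join A B.
Proof. by move=> x Ax C [_ sC]; apply: sC; right. Qed.

Lemma alg_join_min A B C : unital_subalgebra C -> A `<=` C -> B `<=` C ->
  alg_join A B `<=` C.
Proof. by move=> sC AC BC; apply: smallest_sub => //; rewrite subUset. Qed.

(** Used with [C] in the role of [D]: the gradients over the scalars and over [D] are tested on the
    same algebra. *)
Lemma alg_join_absorb A B C : C `<=` B -> alg_join (alg_join A C) B = alg_join A B.
Proof.
move=> CB; rewrite eqEsubset; split; apply: alg_join_min.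
- exact: alg_join_subalg.
- apply: alg_join_min; [exact: alg_join_subalg | exact: alg_join_subl |].
  by apply: (subset_trans CB); exact: alg_join_subr.
- exact: alg_join_subr.
- exact: alg_join_subalg.
- by apply: (subset_trans (@alg_join_subl A C)); exact: alg_join_subl.
- exact: alg_join_subr.
Qed.

End UnitalSubalgebra.

(** * Balanced tensors and derivations *)

Section Tensors.
Variables (R : realType) (M : tracialSpace R).
Implicit Types (C A : set M) (s t : seq (M * M)).

(** A larger [C] only adds balancing relations; this is the canonical surjection between the two
    tensor products. *)
Lemma tens_eq_sub C C' A s t : C `<=` C' -> tens_eq C A s t -> tens_eq C' A s t.
Proof.
move=> CC'; elim=> {s t}.
- by move=> s; exact: tens_refl.
- by move=> s t _; exact: tens_sym.
- by move=> s t r _ st _; exact: tens_trans.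
- by move=> s s' t t' _ ss' _; exact: tens_cat.
- by move=> s t; exact: tens_comm.
- by move=> x x' y *; exact: tens_addl.
- by move=> x y y' *; exact: tens_addr.
- by move=> y *; exact: tens_0l.
- by move=> x *; exact: tens_0r.
- by move=> x c y Ax Cc Ay; apply: tens_bal => //; exact: CC'.
Qed.

Lemma tens_lmul_eq C A a s t : unital_subalgebra A -> A a ->
  tens_eq C A s t -> tens_eq C A (tens_lmul a s) (tens_lmul a t).
Proof.
move=> [_ _ AM] Aa; elim=> {s t}.
- by move=> s; exact: tens_refl.
- by move=> s t _; exact: tens_sym.
- by move=> s t r _ st _; exact: tens_trans.
- by move=> s s' t t' _ ss' _; rewrite /tens_lmul !map_cat; exact: tens_cat.
- by move=> s t; rewrite /tens_lmul !map_cat; exact: tens_comm.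
- by move=> x x' y *; rewrite /tens_lmul /= mulrDr; apply: tens_addl => //; exact: AM.
- by move=> x y y' *; apply: tens_addr => //; exact: AM.
- by move=> y *; rewrite /tens_lmul /= mulr0; exact: tens_0l.
- by move=> x *; apply: tens_0r => //; exact: AM.
- by move=> x c y *; rewrite /tens_lmul /= mulrA; apply: tens_bal => //; exact: AM.
Qed.

Lemma tens_rmul_eq C A a s t : unital_subalgebra A -> A a ->
  tens_eq C A s t -> tens_eq C A (tens_rmul s a) (tens_rmul t a).
Proof.
move=> [_ _ AM] Aa; elim=> {s t}.
- by move=> s; exact: tens_refl.
- by move=> s t _; exact: tens_sym.
- by move=> s t r _ st _; exact: tens_trans.
- by move=> s s' t t' _ ss' _; rewrite /tens_rmul !map_cat; exact: tens_cat.
- by move=> s t; rewrite /tens_rmul !map_cat; exact: tens_comm.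
- by move=> x x' y *; apply: tens_addl => //; exact: AM.
- by move=> x y y' *; rewrite /tens_rmul /= mulrDl; apply: tens_addr => //; exact: AM.
- by move=> y *; apply: tens_0l => //; exact: AM.
- by move=> x *; rewrite /tens_rmul /= mul0r; exact: tens_0r.
- by move=> x c y *; rewrite /tens_rmul /= -mulrA; apply: tens_bal => //; exact: AM.
Qed.

(** The universal property of the tensor product over [C], by induction on the generated
    congruence. *)
Lemma tens_eq_eval C A s t (V : zmodType) (F : M -> M -> V) :
  (forall x x' y, F (x + x') y = F x y + F x' y) ->
  (forall x y y', F x (y + y') = F x y + F x y') ->
  (forall x c y, C c -> F (x * c) y = F x (c * y)) ->
  tens_eq C A s t -> \sum_(p <- s) F p.1 p.2 = \sum_(p <- t) F p.1 p.2.
Proof.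
move=> Fl Fr Fb.
have F0l y : F 0 y = 0 by apply: (addIr (F 0 y)); rewrite -Fl !add0r.
have F0r x : F x 0 = 0 by apply: (addIr (F x 0)); rewrite -Fr !add0r.
elim=> {s t} //.
- by move=> s t r _ -> _ ->.
- by move=> s s' t t' _ ss' _ tt'; rewrite !big_cat /= ss' tt'.
- by move=> s t; rewrite !big_cat /= addrC.
- by move=> x x' y *; rewrite !big_cons !big_nil /= Fl !addr0.
- by move=> x y y' *; rewrite !big_cons !big_nil /= Fr !addr0.
- by move=> y *; rewrite big_cons big_nil /= F0l addr0.
- by move=> x *; rewrite big_cons big_nil /= F0r addr0.
- by move=> x c y *; rewrite !big_cons !big_nil /= Fb.
Qed.

Lemma tens_cat_interchange C A s t r q :
  tens_eq C A ((s ++ t) ++ (r ++ q)) ((s ++ r) ++ (t ++ q)).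
Proof.
rewrite -!catA; apply: tens_cat; first exact: tens_refl.
by rewrite !catA; apply: tens_cat; [exact: tens_comm | exact: tens_refl].
Qed.

Lemma tens_opp_cancel C A x y : unital_subalgebra A -> A x -> A y ->
  tens_eq C A [:: (- x, y); (x, y)] [::].
Proof.
move=> sA Ax Ay; apply: (@tens_trans _ _ _ _ _ [:: (- x + x, y)]).
  by apply/tens_sym/tens_addl => //; exact: subalgN.
by rewrite addNr; exact: tens_0l.
Qed.

(* The set of [a] with [delta a = a (x) 1 - 1 (x) a] is a subalgebra, and it
   contains [C] because both sides vanish there in [A (x)_C A]. *)
Lemma inner_on_join C A A1 delta : unital_subalgebra A -> unital_subalgebra C ->
  C `<=` A -> A1 `<=` A -> derivation C A delta ->
  (forall a, A1 a -> tens_eq C A (delta a) [:: (a, 1); (-1, a)]) ->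
  (forall a, C a -> tens_eq C A (delta a) [::]) ->
  forall a, alg_join A1 C a -> tens_eq C A (delta a) [:: (a, 1); (-1, a)].
Proof.
move=> sA sC CA A1A [_ dL dM] dA1 dC.
have [[A_1 _ AM] [C_1 _ _]] := (sA, sC).
have AN1 : A (-1) by exact: subalgN.
have inC a : C a -> tens_eq C A (delta a) [:: (a, 1); (-1, a)].
  move=> Ca; apply: (tens_trans (dC _ Ca)); apply: tens_sym.
  have Aa : A a by exact: CA.
  apply: (@tens_trans _ _ _ _ _ [:: (-1, a); (1, a)]).
    apply: (@tens_trans _ _ _ _ _ ([:: (-1, a)] ++ [:: (a, 1)])).
      exact: (@tens_comm _ _ _ _ [:: (a, 1)]).
    apply: (@tens_cat _ _ _ _ [:: _] [:: _] [:: _] [:: _]); first exact: tens_refl.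
    by rewrite -{1}[a]mul1r -{2}[a]mulr1; exact: tens_bal.
  exact: tens_opp_cancel.
suff: alg_join A1 C `<=` [set a | A a /\ tens_eq C A (delta a) [:: (a, 1); (-1, a)]].
  by move=> sub a /sub[].
apply: alg_join_min; last 2 first.
- by move=> a A1a; split; [exact: A1A | exact: dA1].
- by move=> a Ca; split; [exact: CA | exact: inC].
split.
- by split=> //; exact: inC.
- move=> k a b [Aa da] [Ab db]; split.
    by apply: subalgD => //; exact: subalgZ.
  have CkA : C k%:A by exact: subalgZ.
  have Aka : A (k *: a) by exact: subalgZ.
  apply: (tens_trans (dL _ _ _ Aa Ab)).
  apply: (tens_trans (tens_cat (tens_lmul_eq sA (CA _ CkA) da) db)).
  apply: (@tens_trans _ _ _ _ _ ([:: (k *: a, 1); (b, 1)] ++ [:: (- 1, k *: a); (- 1, b)])).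
    rewrite /tens_lmul /= mulr_algl mulrN1 -[- k%:A]mulN1r.
    apply: (tens_trans (@tens_cat_interchange _ _ [:: (k *: a, 1)] [:: _] [:: _] [:: _])).
    apply: (@tens_cat _ _ _ _ [:: _; _] [:: _; _] [:: _; _] [:: _; _]).
      exact: tens_refl.
    apply: (@tens_cat _ _ _ _ [:: _] [:: _] [:: _] [:: _]); last exact: tens_refl.
    (* The scalar [k%:A] lies in [C] and is carried across the tensor sign. *)
    by rewrite -[k *: a]mulr_algl; exact: tens_bal.
  by apply: (@tens_cat _ _ _ _ [:: _; _] [:: _] [:: _; _] [:: _]); apply: tens_sym;
    [exact: tens_addl | exact: tens_addr].
- move=> a b [Aa da] [Ab db]; split; first exact: AM.
  apply: (tens_trans (dM _ _ Aa Ab)).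
  apply: (tens_trans (tens_cat (tens_lmul_eq sA Aa db) (tens_rmul_eq sA Ab da))).
  rewrite /tens_lmul /tens_rmul /= mulrN1 mul1r.
  (* Of the four terms given by the Leibniz rule, the two middle ones, [(- a, b)] and [(a, b)],
     cancel. *)
  apply: (@tens_cat _ _ _ _ [:: _] [:: _] [:: _; _; _] [:: _]); first exact: tens_refl.
  apply: (@tens_cat _ _ _ _ [:: _; _] [::] [:: _] [:: _]); last exact: tens_refl.
  exact: tens_opp_cancel.
Qed.

Lemma derivation_sub C C' A delta : C `<=` C' ->
  derivation C A delta -> derivation C' A delta.
Proof.
move=> CC' [dA dL dM]; split => // *; apply: tens_eq_sub CC' _.
  exact: dL.
exact: dM.
Qed.

Lemma liberation_derivation_amalgamate C C' A1 A2 delta :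
  unital_subalgebra C' -> C `<=` C' -> C' `<=` A2 ->
  liberation_derivation C A1 A2 delta ->
  liberation_derivation C' (alg_join A1 C') A2 delta.
Proof.
move=> sC' CC' C'A2 [dd d1 d2]; rewrite /liberation_derivation /= alg_join_absorb //.
have dd' := derivation_sub CC' dd; split => // a Aa; last first.
  by apply: tens_eq_sub CC' _; exact: d2.
apply: inner_on_join Aa => //.
- exact: alg_join_subalg.
- by apply: (subset_trans C'A2); exact: alg_join_subr.
- exact: alg_join_subl.
- by move=> b A1b; apply: tens_eq_sub CC' _; exact: d1.
- by move=> b C'b; apply: tens_eq_sub CC' _; apply: d2; exact: C'A2.
Qed.

(** Where [delta b] and [delta c] are zero, the Leibniz rule leaves only [delta a] multiplied by [b]
    on the left and by [c] on the right. *)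
Lemma derivation_eval_bimod C A delta (F : M -> M -> R[i]) a b c :
  unital_subalgebra A -> derivation C A delta -> A a -> A b -> A c ->
  tens_eq C A (delta b) [::] -> tens_eq C A (delta c) [::] ->
  (forall x x' y, F (x + x') y = F x y + F x' y) ->
  (forall x y y', F x (y + y') = F x y + F x y') ->
  (forall x c y, C c -> F (x * c) y = F x (c * y)) ->
  \sum_(p <- delta (b * a * c)) F p.1 p.2 = \sum_(p <- delta a) F (b * p.1) (p.2 * c).
Proof.
move=> [_ _ AM] [_ _ dM] Aa Ab Ac db dc Fl Fr Fb.
rewrite (tens_eq_eval Fl Fr Fb (dM _ _ (AM _ _ Ab Aa) Ac)) big_cat /= !big_map /=.
(* Each term is evaluated with [F] multiplied in one leg by a fixed element on the outer side, which
   keeps it biadditive and balanced. *)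
rewrite (@tens_eq_eval C A (delta c) [::] _ (fun x y => F (b * a * x) y)) //; first last.
- by move=> x d y Cd; rewrite mulrA Fb.
- by move=> x x' y; rewrite mulrDr Fl.
rewrite big_nil add0r.
rewrite (@tens_eq_eval C A _ _ _ (fun x y => F x (y * c)) _ _ _ (dM _ _ Ab Aa)); first last.
- by move=> x d y Cd; rewrite Fb ?mulrA.
- by move=> x y y'; rewrite mulrDl Fr.
- by move=> x x' y; rewrite Fl.
rewrite big_cat /= !big_map /= -[RHS]addr0; congr (_ + _).
rewrite (@tens_eq_eval C A (delta b) [::] _ (fun x y => F x (y * a * c))) ?big_nil //.
- by move=> x y y'; rewrite !mulrDl Fr.
- by move=> x d y Cd; rewrite Fb ?mulrA.
Qed.

End Tensors.

(** * Freeness with amalgamation over a larger algebra *)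

Section AmalgamatedFreeness.
Variables (R : realType) (M : tracialSpace R).
Implicit Types (A C : set M).

Lemma hom_on_sub (B : algType R[i]) A A' (f : M -> B) : A' `<=` A ->
  hom_on A f -> hom_on A' f.
Proof.
move=> A'A [f1 fL fM]; split=> // [k x y|x y] Ax Ay; first by apply: fL; exact: A'A.
by apply: fM; exact: A'A.
Qed.

(* Both amalgamated products have the same pushout [P]: the canonical map embeds
   [P] in [M], and its inverse provides the structure map of [A1 \/ C']. *)
Lemma alg_free_mod_amalgamate C C' A1 A2 : unital_subalgebra C' ->
  unital_subalgebra A2 -> C `<=` C' -> C' `<=` A2 ->
  alg_free_mod C A1 A2 -> alg_free_mod C' (alg_join A1 C') A2.
Proof.
move=> sC' sA2 CC' C'A2 [P [i1 [i2 [[hi1 hi2 i12 univ] [f [fi1 fi2 f_inj]]]]]].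
have fi1E x : A1 x -> f (i1 x) = x by move=> A1x; apply: fi1; exact: mem_set.
have fi2E x : A2 x -> f (i2 x) = x by move=> A2x; apply: fi2; exact: mem_set.
(* The inverse of the injective [f], with default 0 outside the range; the range contains the join
   of [A1] and [A2]. *)
pose g (x : M) : P := xget 0 [set p | f p = x].
have fgE p : g (f p) = p
  by apply: f_inj; apply: (@xgetPex _ 0 [set q | f q = f p]); exists p.
have gi1 x : A1 x -> g x = i1 x by move=> A1x; rewrite -{1}[x]fi1E.
have gi2 x : A2 x -> g x = i2 x by move=> A2x; rewrite -{1}[x]fi2E.
have range_f : alg_join A1 A2 `<=` range f.
  apply: alg_join_min; first split.
  - by exists 1; rewrite ?rmorph1.
  - by move=> k _ _ [p _ <-] [q _ <-]; exists (k *: p + q); rewrite ?linearP.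
  - by move=> _ _ [p _ <-] [q _ <-]; exists (p * q); rewrite ?rmorphM.
  - by move=> x A1x; exists (i1 x); rewrite ?fi1E.
  - by move=> x A2x; exists (i2 x); rewrite ?fi2E.
have hg : hom_on (alg_join A1 A2) g.
  split; first by rewrite -(rmorph1 f) fgE.
  - by move=> k _ _ /range_f[p _ <-] /range_f[q _ <-]; rewrite -linearP !fgE.
  - by move=> _ _ /range_f[p _ <-] /range_f[q _ <-]; rewrite -rmorphM !fgE.
have join_sub : alg_join A1 C' `<=` alg_join A1 A2.
  apply: alg_join_min; [exact: alg_join_subalg | exact: alg_join_subl |].
  by apply: (subset_trans C'A2); exact: alg_join_subr.
have hg1 := hom_on_sub join_sub hg.
have hg2 := hom_on_sub (@alg_join_subr _ _ A1 A2) hg.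
(* With [g] as both structure maps, their agreement on [C'] is immediate. *)
exists P, g, g; split; last first.
  exists f; split=> // x; rewrite inE.
    by move=> /join_sub/range_f[p _ <-] /=; rewrite fgE.
  by move=> /(@alg_join_subr _ _ A1)/range_f[p _ <-] /=; rewrite fgE.
split=> // B f1 f2 hf1 hf2 f12.
have C'1 : C' `<=` alg_join A1 C' by exact: alg_join_subr.
have [||h [h1 h2 h_uniq]] := univ B f1 f2 _ hf2.
- by apply: hom_on_sub hf1; exact: alg_join_subl.
- by move=> x /[!inE] /CC' C'x; apply: f12; exact: mem_set.
have h1E x : A1 x -> h (g x) = f1 x.
  by move=> A1x; rewrite gi1 //; apply: h1; exact: mem_set.
have h2E x : A2 x -> h (g x) = f2 x.
  by move=> A2x; rewrite gi2 //; apply: h2; exact: mem_set.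
exists h; split.
- move=> x; rewrite inE.
  (* [h \o g] and [f1] are multiplicative and linear on the join, so agreement on [A1] and on [C']
     suffices; on [C'] it comes from [f1 = f2]. *)
  suff sub : alg_join A1 C' `<=` [set x | alg_join A1 C' x /\ h (g x) = f1 x].
    by move=> /sub[].
  have [[[J1 JL JM] [f11 f1L f1M]] [g1 gL gM]] := (alg_join_subalg A1 C', hf1, hg1).
  apply: alg_join_min; first split.
  + by rewrite /= g1 f11 rmorph1.
  + move=> k y z [Jy hy] [Jz hz]; split; first exact: JL.
    by rewrite gL // f1L // -hy -hz; exact: linearP.
  + move=> y z [Jy hy] [Jz hz]; split; first exact: JM.
    by rewrite gM // f1M // -hy -hz; exact: rmorphM.
  + by move=> y A1y; split; [exact: alg_join_subl | exact: h1E].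
  + move=> y C'y; split; first exact: C'1.
    by rewrite h2E; [apply/esym/f12; exact: mem_set | exact: C'A2].
- by move=> x /[!inE]; exact: h2E.
- move=> h' h'1 h'2; apply: h_uniq => x /[!inE] Ax /=.
    by rewrite -gi1 //; apply: h'1; apply: mem_set; exact: alg_join_subl.
  by rewrite -gi2 //; apply: h'2; exact: mem_set.
Qed.

End AmalgamatedFreeness.

(** * The dimension of D counted by matrix units *)

Section Dimension.
Variables (R : realType) (M : tracialSpace R) (D : set M).
Variables (I J : finType) (t : I -> J) (e : I * I -> M).
Hypothesis eP : matrix_units D t e.

Lemma mcoef_munit i : mcoef e (e i) i = (t i.1 == t i.2)%:R.
Proof.
rewrite /mcoef (trace_munit_star eP) eqxx /=.
by case: (_ == _); rewrite ?mul0r // mul1r divff ?(mweight_neq0 eP).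
Qed.

Lemma mcoef_linear i : linear (fun z => mcoef e z i : (R[i])^o).
Proof.
move=> k x y; rewrite /mcoef mulrDl linearD /= -scalerAl linearZ /=.
by rewrite mulrDl -mulrA.
Qed.

(* The two change-of-basis matrices [P] and [Q] satisfy tr(PQ) = tr(QP). *)
Lemma has_dim_munit d : has_dim D d ->
  d%:R = \sum_i (t i.1 == t i.2)%:R :> R[i].
Proof.
move=> [b [b_free Db]].
have bD a : D (b a).
  rewrite Db; exists (fun a' => (a' == a)%:R) => //.
  rewrite (bigD1 a) //= eqxx scale1r big1 ?addr0 // => a' /negbTE->.
  by rewrite scale0r.
(* [Q] expands the units in the basis [b], and [P] expands [b] in the units. [PQ] is the identity,
   while the diagonal of [QP] is 1 within blocks and 0 at the off-block pairs. *)
have /boolp.choice[Q QE] i : exists y : 'I_d -> R[i], \sum_a y a *: b a = e i.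
  by have := munit_in eP i; rewrite Db => -[y _ <-]; exists y.
pose P a i := mcoef e (b a) i.
have PQ a a' : \sum_i P a i * Q i a' = (a == a')%:R.
  apply/eqP; rewrite -subr_eq0; apply/eqP.
  move: a'; apply: b_free.
  under eq_bigr do rewrite scalerBl.
  rewrite sumrB [X in _ - X](bigD1 a) //= eqxx scale1r.
  rewrite [X in b a + X]big1 => [|a']; last first.
    by rewrite eq_sym => /negbTE->; rewrite scale0r.
  rewrite addr0; apply/eqP; rewrite subr_eq0; apply/eqP.
  rewrite -[RHS](mexp_id eP (bD a)) /mexp.
  under eq_bigr do rewrite scaler_suml.
  rewrite exchange_big /=; apply: eq_bigr => i _.
  by rewrite -QE scaler_sumr; apply: eq_bigr => a' _; rewrite scalerA.
have QP i : \sum_a Q i a * P a i = (t i.1 == t i.2)%:R.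
  rewrite -mcoef_munit -[in RHS]QE (linear_pred_sum (mcoef_linear i)).
  by apply: eq_bigr => a _; rewrite (linear_predZ (mcoef_linear i)).
transitivity (\sum_a \sum_i P a i * Q i a).
  under eq_bigr do rewrite PQ eqxx.
  by rewrite sumr_const card_ord.
rewrite exchange_big /=; apply: eq_bigr => i _; rewrite -QP.
by apply: eq_bigr => a _; rewrite mulrC.
Qed.

End Dimension.

(** * Matrix units of a direct sum of matrix algebras *)

Section BlockMatrixUnits.
Variables (R : realType) (M : tracialSpace R) (D : set M).
Variables (k : nat) (n : 'I_k -> nat) (phi : blockIso D n).

Definition bindex : finType := {j : 'I_k & 'I_(n j)}.

Definition bindex_tag (p : bindex) : 'I_k := tag p.

Definition bindex_of j (x : 'I_(n j)) : bindex := Tagged (fun j => 'I_(n j)) x.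

Definition block_unit (i : bindex * bindex) : M :=
  phi (fun j => \matrix_(x, y) ((bindex_of x == i.1) && (bindex_of y == i.2))%:R).

Lemma sum_bindex_of (V : pzSemiRingType) j (q : bindex) :
  \sum_(x < n j) (bindex_of x == q)%:R = (bindex_tag q == j)%:R :> V.
Proof.
case: q => i y; rewrite /bindex_tag /=; have [ij|ij] := eqVneq i j.
  subst j; rewrite (bigD1 y) //= eqxx big1 ?addr0 // => x xy.
  by rewrite /bindex_of eq_Tagged /= (negbTE xy).
apply: big1 => x _; case: eqP => // /(congr1 tag) /= ji.
by rewrite ji eqxx in ij.
Qed.

Lemma bindex_of_inj j : injective (@bindex_of j).
Proof. by move=> x y /eqP; rewrite /bindex_of eq_Tagged => /eqP. Qed.

Lemma block0 : phi (fun j => 0) = 0.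
Proof.
have := block_linear phi 1 (fun j => 0) (fun j => 0).
have -> : (fun j => 1 *: (0 : 'M[R[i]]_(n j)) + 0) = (fun j => 0).
  by apply: functional_extensionality_dep => j; rewrite scale1r addr0.
by rewrite scale1r => /eqP; rewrite -subr_eq subrr eq_sym => /eqP.
Qed.

Lemma blockZ a X : phi (fun j => a *: X j) = a *: phi X.
Proof.
have := block_linear phi a X (fun j => 0); rewrite block0 addr0 => <-.
by congr (phi _); apply: functional_extensionality_dep => j; rewrite addr0.
Qed.

Lemma block_lincomb (J : finType) (c : J -> R[i]) (X : J -> forall j, 'M[R[i]]_(n j)) :
  phi (fun j => \sum_i c i *: X i j) = \sum_i c i *: phi (X i).
Proof.
elim: (index_enum J) => [|i r IH]; last first.
  rewrite big_cons -IH -block_linear; congr (phi _).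
  by apply: functional_extensionality_dep => j; rewrite big_cons.
rewrite big_nil -[RHS]block0; congr (phi _).
by apply: functional_extensionality_dep => j; rewrite big_nil.
Qed.

Lemma blockE (X Y : forall j, 'M[R[i]]_(n j)) :
  (forall j x y, X j x y = Y j x y) -> phi X = phi Y.
Proof.
move=> XY; congr (phi _); apply: functional_extensionality_dep => j.
by apply/matrixP => x y; exact: XY.
Qed.

(** Serves twice: [P] always true gives the unit of [M], and [P] selecting one block gives a minimal
    central projection. *)
Lemma block_unit_diag_sum (P : pred bindex) :
  \sum_(p | P p) block_unit (p, p) =
  phi (fun j => \matrix_(x, y) ((x == y) && P (bindex_of x))%:R).
Proof.
transitivity (\sum_p (P p)%:R *: block_unit (p, p)).
  rewrite big_mkcond /=; apply: eq_bigr => p _.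
  by case: (P p); rewrite ?scale1r ?scale0r.
rewrite -block_lincomb; apply: blockE => j x y.
rewrite summxE (bigD1 (bindex_of x)) //= big1 => [|p px]; last first.
  by rewrite !mxE eq_sym (negbTE px) mulr0.
rewrite !mxE eqxx addr0 /= (inj_eq (@bindex_of_inj j)) eq_sym.
by case: (x == y); rewrite /= ?mulr1 ?mulr0.
Qed.

Lemma block_matrix_units : matrix_units D bindex_tag block_unit.
Proof.
split.
- move=> p q pq; rewrite -block0; apply: blockE => j x y; rewrite !mxE /=.
  case: eqP => //= xp; case: eqP => //= yq.
  by rewrite -xp -yq /bindex_tag /= eqxx in pq.
- move=> p q r s; rewrite /block_unit -block_mul -blockZ.
  apply: blockE => j x y; rewrite !mxE /=.
  under eq_bigr do rewrite !mxE /=.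
  case: (bindex_of x =P p) => [xp|_] /=; last by rewrite mulr0 big1 // => *; rewrite mul0r.
  case: (bindex_of y == s); last by rewrite mulr0 big1 // => *; rewrite andbF mulr0.
  rewrite mulr1; case: (eqVneq q r) => [<-|qr] /=; last first.
    rewrite big1 // => z _; rewrite andbT.
    by case: eqP => [->|]; rewrite ?mul0r // (negbTE qr) mulr0.
  rewrite -xp {1}/bindex_tag /= eq_sym -(sum_bindex_of _ j q).
  by apply: eq_bigr => z _; rewrite andbT; case: (_ == _); rewrite ?mulr1 ?mulr0.
- move=> p q; rewrite /block_unit -block_star; apply: blockE => j x y.
  by rewrite !mxE /= rmorph_nat andbC.
- rewrite (block_unit_diag_sum xpredT) -(block_one phi).
  by apply: blockE => j x y; rewrite !mxE andbT.
- case=> j x; apply/eqP; rewrite -[RHS]block0 => /block_inj.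
  move/(congr1 (fun X : forall j, 'M[R[i]]_(n j) => X j x x)).
  by rewrite !mxE /= !eqxx /= => /eqP; rewrite oner_eq0.
- rewrite -(block_range phi) eqEsubset; split=> [_ [X _ <-]|_ [y _ <-]].
    (* [tagged_as] casts the column index to the block of the row index; between different blocks it
       yields a default, cancelled by the factor in front. *)
    pose y (i : bindex * bindex) : R[i] :=
      (bindex_tag i.1 == bindex_tag i.2)%:R *
      X (tag i.1) (tagged i.1) (tagged_as i.1 i.2).
    exists y => //; rewrite -block_lincomb; apply: blockE => j u v.
    rewrite summxE (bigD1 (bindex_of u, bindex_of v)) //= big1 => [|[p q] pq].
      by rewrite !mxE /= !eqxx mulr1 addr0 /y /= eqxx mul1r tagged_asE.
    rewrite !mxE /= !(eq_sym (bindex_of _)).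
    by move: pq; rewrite xpair_eqE => /negbTE->; rewrite mulr0.
  exists (fun j => \sum_i y i *: \matrix_(u, v)
    ((bindex_of u == i.1) && (bindex_of v == i.2))%:R) => //.
  by rewrite block_lincomb.
Qed.

End BlockMatrixUnits.

(** * Diagonal elements and the constant c *)

Section MatrixUnitDiagonal.
Variables (R : realType) (M : tracialSpace R) (D : set M).
Variables (I J : finType) (t : I -> J) (e : I * I -> M).
Hypothesis eP : matrix_units D t e.

Lemma munit_diag_mulr (a : I -> R[i]) p q :
  (\sum_r a r *: e (r, r)) * e (p, q) = a p *: e (p, q).
Proof.
rewrite mulr_suml (bigD1 p) //= big1 => [|r /negbTE rp].
  by rewrite addr0 -scalerAl (munit_mul eP) !eqxx scale1r.
by rewrite -scalerAl (munit_mul eP) rp scale0r scaler0.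
Qed.

Lemma munit_diag_mull (a : I -> R[i]) p q :
  e (p, q) * (\sum_r a r *: e (r, r)) = a q *: e (p, q).
Proof.
rewrite mulr_sumr (bigD1 q) //= big1 => [|r /negbTE rq].
  rewrite addr0 -scalerAr (munit_mul eP) eqxx.
  case: (eqVneq (t p) (t q)) => [_|/(munit_off eP)->]; first by rewrite scale1r.
  by rewrite !scaler0.
by rewrite -scalerAr (munit_mul eP) eq_sym rq scale0r scaler0.
Qed.

Lemma munit_diagM (a b : I -> R[i]) :
  (\sum_p a p *: e (p, p)) * (\sum_p b p *: e (p, p)) =
  \sum_p (a p * b p) *: e (p, p).
Proof.
rewrite mulr_sumr; apply: eq_bigr => p _.
by rewrite -scalerAr munit_diag_mulr scalerA mulrC.
Qed.

End MatrixUnitDiagonal.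

Section LiberationConstant.
Variables (R : realType) (M : tracialSpace R) (D : set M).
Variables (k : nat) (n : 'I_k -> nat) (phi : blockIso D n).

Let e := block_unit phi.
Let eP := block_matrix_units phi.
Let N := (\sum_j n j ^ 2)%N.

Lemma central_projE j :
  central_proj phi j = \sum_(p | bindex_tag p == j) e (p, p).
Proof.
rewrite block_unit_diag_sum; apply: blockE => i x y; rewrite !mxE /bindex_tag /=.
by case: (x == y); rewrite ?mulr1n ?mulr0n.
Qed.

Lemma card_bindex_tag j : #|[pred p : bindex n | bindex_tag p == j]| = n j.
Proof.
rewrite -[RHS](card_ord (n j)) -(fintype.card_image (@bindex_of_inj _ n j)).
apply: eq_card => -[i y]; rewrite inE.
apply/eqP/fintype.imageP => [ij|[x _ ->]] //.
by rewrite /bindex_tag /= in ij; subst j; exists y.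
Qed.

Lemma sum_bindex_tag (V : nmodType) j (x : V) :
  \sum_(p : bindex n | bindex_tag p == j) x = x *+ n j.
Proof. by rewrite sumr_const card_bindex_tag. Qed.

Lemma trace_central_proj p :
  trace M (central_proj phi (bindex_tag p)) = (n (bindex_tag p))%:R * mweight e p.
Proof.
rewrite central_projE linear_sum /= mulr_natl -sum_bindex_tag; apply: eq_bigr => q /eqP.
by move/(mweight_class eP).
Qed.

Lemma block_dim : N%:R = \sum_(i : bindex n * bindex n)
    (bindex_tag i.1 == bindex_tag i.2)%:R :> R[i].
Proof.
rewrite -(pair_bigA _ (fun p q => (bindex_tag p == bindex_tag q)%:R)) /=.
rewrite /N natr_sum (partition_big (@bindex_tag _ n) xpredT) //=.
apply: eq_bigr => j _.
transitivity (\sum_(p : bindex n | bindex_tag p == j) (n j)%:R : R[i]).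
  by rewrite sum_bindex_tag -mulrnA mulnn.
apply: eq_bigr => p /eqP pj.
rewrite -(sum_bindex_tag j 1) big_mkcond /=; apply: eq_bigr => q _.
by rewrite pj eq_sym; case: (_ == _).
Qed.

Lemma block_dim_gt0 : (0 < N)%N.
Proof.
(* Without indices the unit of [M] would be an empty sum, hence 0. *)
have /card_gt0P[p _] : (0 < #|{: bindex n}|)%N.
  rewrite lt0n; apply: contraTneq isT => I0.
  have := oner_neq0 M; rewrite -(munit_one eP) big1 ?eqxx // => p.
  by have := fintype0 p I0.
by rewrite /N (bigD1 (bindex_tag p)) //= ltn_addr // expn_gt0 (block_size_gt0 phi).
Qed.

Lemma block_size_neq0 (p : bindex n) : (n (bindex_tag p))%:R != 0 :> R[i].
Proof. by rewrite pnatr_eq0 -lt0n (block_size_gt0 phi). Qed.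

(** [tau(p_j)] is [n j] times the common weight in block [j], which cancels one factor of
    [n j ^ 2]. *)
Lemma liberation_cE : liberation_c phi =
  \sum_p (N%:R * (mweight e p / (n (bindex_tag p))%:R)) *: e (p, p).
Proof.
rewrite /liberation_c -/N scaler_sumr.
rewrite [RHS](partition_big (@bindex_tag _ n) xpredT) //=.
apply: eq_bigr => j _; rewrite scalerA central_projE scaler_sumr.
apply: eq_bigr => p /eqP pj; congr (_ * _ *: _).
rewrite -central_projE -pj trace_central_proj natrX expr2 invfM mulrA.
by rewrite (mulrC _%:R) mulfK ?block_size_neq0.
Qed.

Lemma liberation_cV : (liberation_c phi)^-1 =
  \sum_p (N%:R * (mweight e p / (n (bindex_tag p))%:R))^-1 *: e (p, p).
Proof.
have w_neq0 p : N%:R * (mweight e p / (n (bindex_tag p))%:R) != 0 :> R[i].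
  rewrite !mulf_neq0 ?invr_neq0 ?block_size_neq0 ?(mweight_neq0 eP) //.
  by rewrite pnatr_eq0 -lt0n block_dim_gt0.
set y := RHS.
have cy : liberation_c phi * y = 1.
  rewrite liberation_cE (munit_diagM eP) -(munit_one eP); apply: eq_bigr => p _.
  by rewrite divff ?scale1r.
have yc : y * liberation_c phi = 1.
  rewrite liberation_cE (munit_diagM eP) -(munit_one eP); apply: eq_bigr => p _.
  by rewrite mulVf ?scale1r.
(* [x^-1] denotes an inverse only for units, so invertibility on both sides comes first. *)
have cU : liberation_c phi \is a GRing.unit by apply/unitrP; exists y.
by rewrite -[LHS]mulr1 -cy mulrA mulVr ?mul1r.
Qed.

End LiberationConstant.

(** * Complex continuity and invariance of integrals *)

Section ComplexContinuity.
Variable R : realType.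

Lemma near_normB_lt (z eps : R[i]) : 0 < eps ->
  \forall w \near (z : (R[i])^o), `|z - w| < eps.
Proof. by move=> eps0; exact: (@nbhsx_ballx _ (R[i])^o). Qed.

Lemma Re_continuous : continuous (fun z : (R[i])^o => complex.Re z : R).
Proof.
move=> z; apply/(@cvgrPdist_lt _ R _ _ (@nbhs_filter (R[i])^o z)) => eps eps0.
have eps0' : 0 < eps%:C by rewrite ltcR.
apply: filterS (near_normB_lt z eps0') => w zw.
rewrite -ltcR (_ : complex.Re z - complex.Re w = complex.Re (z - w)).
  exact: le_lt_trans (normc_ge_Re _) zw.
by case: z w {zw} => [a b] [c d].
Qed.

Lemma conj_continuous : continuous (fun z : (R[i])^o => z^* : (R[i])^o).
Proof.
move=> z; apply/(@cvgrPdist_lt _ (R[i])^o _ _ (@nbhs_filter (R[i])^o z)) => eps eps0.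
apply: filterS (near_normB_lt z eps0) => w zw.
by rewrite -rmorphB norm_conjC.
Qed.

(** Lets integrability of imaginary parts be deduced from that of real parts. *)
Lemma Im_Re (z : R[i]) : complex.Im z = complex.Re (- 'i%C * z).
Proof. by case: z => a b; rewrite /= oppr0 mul0r sub0r mulN1r opprK. Qed.

End ComplexContinuity.

(** Invariance says that the push-forward of [mu] along [g] is [mu]. The change of variables needs
    [h \o g] integrable, which comes from its nonnegative version applied to the absolute value of
    [h]. *)
Lemma Rintegral_invariant (R : realType) d (X : measurableType d)
    (mu : {measure set X -> \bar R}) (g : X -> X) (h : X -> R) :
  measurable_fun setT g ->
  (forall B, measurable B -> mu (g @^-1` B) = mu B) ->
  mu.-integrable setT (EFin \o h) ->
  \int[mu]_(x in setT) h (g x) = \int[mu]_(x in setT) h x.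
Proof.
move=> mg mu_g /integrableP[/measurable_EFinP mh h_fin].
have push_mu (f : X -> \bar R) :
    (\int[pushforward mu g]_(x in setT) f x = \int[mu]_(x in setT) f x)%E.
  by apply: eq_measure_integral => B mB _; exact: mu_g.
have hg_int : mu.-integrable (g @^-1` setT) ((EFin \o h) \o g).
  apply/integrableP; rewrite preimage_setT; split.
    by apply/measurable_EFinP; exact: measurableT_comp mg.
  rewrite -(push_mu (fun x => `|(EFin \o h) x|%E)) ge0_integral_pushforward // in h_fin.
  by apply: measurableT_comp => //; exact/measurable_EFinP.
by congr fine; rewrite -(integral_pushforward mg _ hg_int) //; apply/measurable_EFinP.
Qed.

(** * Complex integrals over the unitary group *)

Section ComplexIntegral.
Variables (R : realType) (M : tracialSpace R) (D : starSubalg M) (L : l2Space M).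
Variable mu : probability (unitary_borel D L) R.
Implicit Types f g : unitary D -> R[i].

Let T : measurableType _ := unitary_borel D L.

Definition cintegrable f :=
  mu.-integrable setT (EFin \o (@complex.Re R \o f : T -> R)) /\
  mu.-integrable setT (EFin \o (@complex.Im R \o f : T -> R)).

(** Integrability is returned together with the value, so that these rules can be iterated over
    finite sums. *)
Lemma CintegralZ c f : cintegrable f ->
  cintegrable (fun u => c * f u) /\
  Cintegral mu (fun u => c * f u) = c * Cintegral mu f.
Proof.
move=> [fr fi]; case: c => a b.
have ReE : @complex.Re R \o (fun u => (a +i* b) * f u) =
    (fun u => a * complex.Re (f u) - b * complex.Im (f u)).
  by apply/funext => u /=; case: (f u).
have ImE : @complex.Im R \o (fun u => (a +i* b) * f u) =
    (fun u => a * complex.Im (f u) + b * complex.Re (f u)).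
  by apply/funext => u /=; case: (f u).
have intZ k (h : T -> R) : mu.-integrable setT (EFin \o h) ->
    mu.-integrable setT (EFin \o (fun u => k * h u)).
  by move=> hi; have := integrableZl measurableT k hi.
have Nb : (fun u => a * complex.Re (f u) - b * complex.Im (f u)) =
    (fun u => a * complex.Re (f u) + (- b) * complex.Im (f u)).
  by apply/funext => u; rewrite mulNr.
split.
  split.
    rewrite ReE Nb.
    by have := integrableD measurableT (intZ a _ fr) (intZ (- b) _ fi).
  rewrite ImE.
  by have := integrableD measurableT (intZ a _ fi) (intZ b _ fr).
rewrite /Cintegral.
have -> : \int[mu]_(u in setT) complex.Re ((a +i* b) * f u) =
    a * (\int[mu]_(u in setT) complex.Re (f u)) - b * (\int[mu]_(u in setT) complex.Im (f u)).
  transitivity (\int[mu]_(u in setT) (a * complex.Re (f u) + (- b) * complex.Im (f u))).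
    by congr (Rintegral mu setT _); rewrite -Nb -ReE.
  rewrite RintegralD //; [|exact: intZ|exact: intZ].
  by rewrite !RintegralZl // mulNr.
have -> : \int[mu]_(u in setT) complex.Im ((a +i* b) * f u) =
    a * (\int[mu]_(u in setT) complex.Im (f u)) + b * (\int[mu]_(u in setT) complex.Re (f u)).
  transitivity (\int[mu]_(u in setT) (a * complex.Im (f u) + b * complex.Re (f u))).
    by congr (Rintegral mu setT _); rewrite -ImE.
  rewrite RintegralD //; [|exact: intZ|exact: intZ].
  by rewrite !RintegralZl.
by [].
Qed.

Lemma CintegralD f g : cintegrable f -> cintegrable g ->
  cintegrable (fun u => f u + g u) /\
  Cintegral mu (fun u => f u + g u) = Cintegral mu f + Cintegral mu g.
Proof.
move=> [fr fi] [gr gi].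
have ReD : @complex.Re R \o (fun u => f u + g u) =
    (fun u => complex.Re (f u) + complex.Re (g u)).
  by apply/funext => u /=; case: (f u) (g u) => [? ?] [].
have ImD : @complex.Im R \o (fun u => f u + g u) =
    (fun u => complex.Im (f u) + complex.Im (g u)).
  by apply/funext => u /=; case: (f u) (g u) => [? ?] [].
split.
  split.
    by rewrite ReD; have := integrableD measurableT fr gr.
  by rewrite ImD; have := integrableD measurableT fi gi.
rewrite /Cintegral; congr (_ +i* _).
  rewrite -RintegralD //; congr (Rintegral mu setT _); exact: ReD.
rewrite -RintegralD //; congr (Rintegral mu setT _); exact: ImD.
Qed.

Lemma Cintegral_cst c : cintegrable (fun=> c) /\ Cintegral mu (fun=> c) = c.
Proof.
split; first by split; exact: finite_measure_integrable_cst.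
rewrite /Cintegral !Rintegral_cst //.
have mu1 : fine (mu setT) = 1 := congr1 fine (probability_setT mu).
by case: c => a b; congr (_ +i* _); rewrite -[RHS]mulr1; congr (_ * _).
Qed.

Lemma Cintegral_lincomb (I : Type) (r : seq I) (c : I -> R[i])
    (f : I -> unitary D -> R[i]) : (forall i, cintegrable (f i)) ->
  cintegrable (fun u => \sum_(i <- r) c i * f i u) /\
  Cintegral mu (fun u => \sum_(i <- r) c i * f i u) =
    \sum_(i <- r) c i * Cintegral mu (f i).
Proof.
move=> fint; elim: r => [|i r [IHi IHe]].
  have -> : (fun u => \sum_(i <- [::]) c i * f i u) = (fun=> 0).
    by apply/funext => u; rewrite big_nil.
  by rewrite big_nil; exact: Cintegral_cst.
have -> : (fun u => \sum_(j <- i :: r) c j * f j u) =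
    (fun u => c i * f i u + \sum_(j <- r) c j * f j u).
  by apply/funext => u; rewrite big_cons.
have [cfi cfe] := CintegralZ (c i) (fint i).
by have [si ->] := CintegralD cfi IHi; rewrite big_cons cfe IHe.
Qed.

Lemma continuous_unitary_measurable (h : unitary_topology D L -> R) :
  continuous h -> measurable_fun setT (h : T -> R).
Proof.
move=> /continuousP ch; apply: (measurability _ (RGenOpens.measurableE R)).
move=> _ [_ [x [y ->] <-]]; rewrite setTI.
by apply: sub_sigma_algebra; apply: ch; exact: interval_open.
Qed.

Lemma cintegrable_continuous f (K : R[i]) :
  continuous (f : unitary_topology D L -> (R[i])^o) ->
  (forall u, `|f u| <= K) -> cintegrable f.
Proof.
move=> cf fK.
have intRe g : continuous (g : unitary_topology D L -> (R[i])^o) ->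
    (forall u, `|g u| <= K) -> mu.-integrable setT (EFin \o (@complex.Re R \o g : T -> R)).
  move=> cg gK; apply: measurable_bounded_integrable => //.
  - exact: (eq_ind_r (fun x => (x < +oo)%E) (ltry (1 : R)) (probability_setT mu)).
  - apply: continuous_unitary_measurable.
    exact: continuous_compose cg (@Re_continuous R).
  - exists (complex.Re K); split; first exact: num_real.
    move=> y Ky u _; apply: (le_trans _ (ltW Ky)).
    by have := le_trans (normc_ge_Re _) (gK u); rewrite lecE => /andP[].
split; first exact: intRe.
have -> : @complex.Im R \o f = @complex.Re R \o (fun u => - 'i%C * f u).
  by apply/funext => u /=; rewrite Im_Re.
apply: intRe => [|u]; first exact: continuous_compose cf (@mulrl_continuous R[i] _).
by rewrite normrM normrN (_ : `|'i%C| = 1) ?mul1r // normc_def /= expr0n expr1n add0r sqrtr1.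
Qed.

Lemma Cintegral_translate (v : unitary D) f : is_haar mu ->
  cintegrable f -> Cintegral mu (fun u => f (unitary_mul v u)) = Cintegral mu f.
Proof.
move=> haar_mu [fr fi].
have mv : measurable_fun setT (unitary_mul v : T -> T).
  apply: (@measurability _ _ T T setT _ (@open (unitary_topology D L)) erefl).
  move=> _ [U oU <-]; rewrite setTI.
  apply: sub_sigma_algebra; move: U oU; apply/continuousP.
  apply: continuous_comp_initial.
  (* Seen in L^2, translation by [v] is left multiplication by [v], hence continuous for the initial
     topology. *)
  have -> : (l2_in L \o val) \o unitary_mul v = l2_lmul L (val v) \o (l2_in L \o val).
    by apply/funext => u /=; rewrite l2_lmulE.
  apply: continuous_compose; first exact: initial_continuous.
  exact: l2_lmul_continuous.
have inv_mu (B : set T) : measurable B -> mu (unitary_mul v @^-1` B) = mu B.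
  exact: haar_mu.
rewrite /Cintegral; congr (_ +i* _).
  exact: (Rintegral_invariant mv inv_mu fr).
exact: (Rintegral_invariant mv inv_mu fi).
Qed.

End ComplexIntegral.

(** * Schur orthogonality and the average over the unitary group *)

Lemma sum_pair (V : nmodType) (I J : finType) (F : I * J -> V) :
  \sum_i F i = \sum_a \sum_b F (a, b).
Proof. by rewrite pair_bigA; apply: eq_bigr => -[]. Qed.

Definition class_size (I J : finType) (t : I -> J) p := #|[pred q | t q == t p]|.

Section SchurOrthogonality.
Variables (R : realType) (M : tracialSpace R) (D : starSubalg M) (L : l2Space M).
Variable mu : probability (unitary_borel D L) R.
Hypothesis haar_mu : is_haar mu.
Variables (I J : finType) (t : I -> J) (e : I * I -> M).
Hypothesis eP : matrix_units D t e.

Let x (u : unitary D) i : R[i] := mcoef e (val u) i.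

Lemma mcoefD y z i : mcoef e (y + z) i = mcoef e y i + mcoef e z i.
Proof. exact: (linear_predD (mcoef_linear e i)). Qed.

Lemma mcoefZ k z i : mcoef e (k *: z) i = k * mcoef e z i.
Proof. exact: (linear_predZ (mcoef_linear e i)). Qed.

Lemma mcoefB y z i : mcoef e (y - z) i = mcoef e y i - mcoef e z i.
Proof. by rewrite mcoefD -scaleN1r mcoefZ mulN1r. Qed.

Lemma unitaryP (u : unitary D) : is_unitary_in D (val u).
Proof. by case: u => u /= /asboolP. Qed.

(** The normalising weights of [r] and [s] agree within a block, so the unit simply moves row [s] to
    row [r]. *)
Lemma mcoef_munitM r s z a b : mcoef e (e (r, s) * z) (a, b) =
  ((a == r) && (t r == t s))%:R * mcoef e z (s, b).
Proof.
rewrite /mcoef !(munit_star eP) -mulrA traceC -mulrA (munit_mul eP).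
rewrite -scalerAr linearZ /=.
have [->|ar] /= := eqVneq a r; last by rewrite !mul0r.
have [rs|rs] := eqVneq (t r) (t s); last first.
  have [br|br] := eqVneq (t b) (t r); last by rewrite !mul0r.
  by rewrite (munit_off eP) ?br // mulr0 linear0 mulr0 !mul0r.
rewrite mul1r (mweight_class eP rs); have [br|br] := eqVneq (t b) (t r).
  by rewrite mul1r.
by rewrite mul0r (munit_off eP) ?mulr0 ?linear0 ?mul0r // -rs.
Qed.

Lemma mcoef_off z p q : t p != t q -> mcoef e z (p, q) = 0.
Proof. by move=> pq; rewrite /mcoef (munit_off eP) // star0 mulr0 linear0 mul0r. Qed.

Lemma unitary_coord_continuous i :
  continuous ((fun u => x u i) : unitary_topology D L -> (R[i])^o).
Proof.
have -> : (fun u : unitary D => x u i) =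
    (fun z => (mweight e i.1)^-1 * z) \o
    ((fun xi : L => dot L xi (l2_in L (e i))) \o (l2_in L \o val)).
  by apply/funext => u /=; rewrite l2_dot mulrC.
apply: (@continuous_compose _ _ (R[i])^o); last exact: (@mulrl_continuous R[i]).
by apply: continuous_compose; [exact: initial_continuous | exact: dot_continuousl].
Qed.

(** Cauchy-Schwarz, a unitary having L^2 norm 1. *)
Lemma unitary_coord_bound i u : `|x u i| <= `|l2_in L (e i)| / mweight e i.1.
Proof.
rewrite /x /mcoef normrM normfV (gtr0_norm (mweight_gt0 eP _)).
rewrite ler_wpM2r ?invr_ge0 ?(ltW (mweight_gt0 eP _)) // -(l2_dot L).
have -> : `|l2_in L (e i)| = `|l2_in L (val u)| * `|l2_in L (e i)|.
  suff -> : `|l2_in L (val u)| = 1 by rewrite mul1r.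
  apply/eqP; rewrite -(@eqrXn2 _ 2) ?expr1n // dot_norm l2_dot.
  by have [_ _ ->] := unitaryP u; rewrite trace1.
exact: dot_CauchySchwarz.
Qed.

Lemma cintegrable_coord i j : cintegrable mu (fun u => x u i * (x u j)^*).
Proof.
apply: (@cintegrable_continuous _ _ _ _ _ _
  ((`|l2_in L (e i)| / mweight e i.1) * (`|l2_in L (e j)| / mweight e j.1))).
  have cj := continuous_compose (@unitary_coord_continuous j) (@conj_continuous R).
  by move=> u; have := cvgM (@unitary_coord_continuous i u) (cj u); apply.
by move=> u; rewrite normrM norm_conjC ler_pM ?unitary_coord_bound.
Qed.

(** This is the coefficient at [(d, b)] of [star M u * u = 1]. *)
Lemma unitary_columns_orthonormal u b d :
  \sum_(a | t a == t d) x u (a, b) * (x u (a, d))^* = (b == d)%:R.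
Proof.
have [Du uu _] := unitaryP u.
have := congr1 (fun z => mcoef e z (d, b)) uu.
rewrite -{1}(mexp_id eP Du) (star_linear_sum e) mulr_suml.
rewrite (linear_pred_sum (mcoef_linear e (d, b))).
rewrite (_ : mcoef e 1 (d, b) = (b == d)%:R); last first.
  rewrite /mcoef mul1r (munit_star eP) (trace_munit eP).
  by case: eqP => [->|_]; rewrite ?mul0r // mul1r divff ?(mweight_neq0 eP).
move=> <-; rewrite sum_pair.
rewrite big_mkcond; apply: eq_bigr => a _ /=.
rewrite (bigD1 d) //= big1 ?addr0 => [|d' /negbTE dd'].
  rewrite -[in RHS]scalerAl (linear_predZ (mcoef_linear e (d, b))) (munit_star eP).
  rewrite mcoef_munitM eqxx eq_sym /= /x; case: (_ == _); last by rewrite mul0r scaler0.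
  by rewrite mul1r; exact: mulrC.
rewrite -scalerAl (linear_predZ (mcoef_linear e (d, b))) (munit_star eP).
by rewrite mcoef_munitM eq_sym dd' mul0r scaler0.
Qed.

(** Half of [w] is a projection, and [1 - w] is the reflection belonging to it. *)
Lemma reflection_unitary w : (D : set M) w -> star M w = w -> w * w = 2 *: w ->
  is_unitary_in D (1 - w).
Proof.
move=> Dw sw ww; have [[D1 DL _] _] := star_subalgP D.
have sE : star M (1 - w) = 1 - w.
  by rewrite -scaleN1r addrC star_antilinear star1 sw rmorphN rmorph1.
have uu : (1 - w) * (1 - w) = 1.
  by rewrite mulrBl mul1r mulrBr mulr1 ww scaler_nat mulr2n opprB addrK subrK.
split; rewrite ?sE //.
by rewrite -scaleN1r addrC; exact: DL.
Qed.

Lemma Cintegral_coord_reflect w i j : (D : set M) w -> star M w = w -> w * w = 2 *: w ->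
  Cintegral mu (fun u => (x u i - mcoef e (w * val u) i) *
    (x u j - mcoef e (w * val u) j)^*) =
  Cintegral mu (fun u => x u i * (x u j)^*).
Proof.
move=> Dw sw ww; have /asboolP vP := reflection_unitary Dw sw ww.
pose v : unitary D := exist _ (1 - w) vP.
rewrite -[RHS](Cintegral_translate v haar_mu (cintegrable_coord i j)).
have xE u l : mcoef e (val u) l - mcoef e (w * val u) l = mcoef e ((1 - w) * val u) l.
  by rewrite mulrBl mul1r mcoefB.
by congr (Cintegral mu _); apply/funext => u; rewrite /x /= !xE.
Qed.

(** The reflection [1 - 2 e_aa] changes the sign of row [a] and fixes row [c], so the integral
    equals its own negative. *)
Lemma Cintegral_coord_diff_row a b c d : a != c ->
  Cintegral mu (fun u => x u (a, b) * (x u (c, d))^*) = 0.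
Proof.
move=> ac; set f := fun u => _; pose w := (2 : R[i]) *: e (a, a).
have [] := CintegralZ (-1) (cintegrable_coord (a, b) (c, d)).
have -> : (fun u => -1 * (x u (a, b) * (x u (c, d))^*)) =
    (fun u => (x u (a, b) - mcoef e (w * val u) (a, b)) *
      (x u (c, d) - mcoef e (w * val u) (c, d))^*).
  apply/funext => u; have -> : w * val u = 2 *: (e (a, a) * val u) by rewrite -scalerAl.
  rewrite !mcoefZ !mcoef_munitM !eqxx.
  rewrite eq_sym (negbTE ac) mul0r mulr0 subr0 !mul1r mulN1r -mulNr; congr (_ * _).
  by rewrite mulr_natl mulr2n opprD addrA subrr sub0r.
rewrite Cintegral_coord_reflect.
- move=> _ /eqP; rewrite mulN1r -addr_eq0 -mulr2n mulrn_eq0 /= => /eqP.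
  by rewrite /f => <-.
- by have [sD _] := star_subalgP D; apply: (subalgZ _ sD); exact: munit_in eP _.
- have := star_antilinear (2 : R[i]) (e (a, a)) 0.
  by rewrite star0 !addr0 (munit_star eP) rmorph_nat.
- by rewrite /w -scalerAl -scalerAr (munit_mul eP) !eqxx scale1r.
Qed.

Lemma Cintegral_coord_swap_row a a' b d : t a = t a' ->
  Cintegral mu (fun u => x u (a, b) * (x u (a, d))^*) =
  Cintegral mu (fun u => x u (a', b) * (x u (a', d))^*).
Proof.
move=> aa'; have [->//|neq_aa'] := eqVneq a a'.
have neq_a'a : a' != a by rewrite eq_sym.
(* Chosen so that [1 - w] swaps the rows [a] and [a']. *)
pose w := (e (a, a) + e (a', a')) - (e (a, a') + e (a', a)).
have [sD _] := star_subalgP D.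
have ein i : (D : set M) (e i) := munit_in eP i.
have wE u c : x u (a, c) - mcoef e (w * val u) (a, c) = x u (a', c).
  rewrite /w mulrBl mcoefB !mulrDl !mcoefD !mcoef_munitM !eqxx aa' eqxx.
  rewrite (negbTE neq_aa') !mul0r !mul1r !addr0.
  by rewrite opprB addrCA subrr addr0.
rewrite -(@Cintegral_coord_reflect w).
- by congr (Cintegral mu _); apply/funext => u; rewrite !wE.
- by rewrite /w; apply: subalgD => //; [|apply: subalgN => //]; exact: subalgD.
- have starD y z : star M (y + z) = star M y + star M z.
    by have := star_antilinear (1 : R[i]) y z; rewrite rmorph1 !scale1r.
  have starB y z : star M (y - z) = star M y - star M z.
    by rewrite -[- z]scaleN1r [y + _]addrC star_antilinear rmorphN rmorph1 scaleN1r addrC.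
  by rewrite /w starB !starD !(munit_star eP) [e (a', a) + _]addrC.
- rewrite /w mulrBl !mulrBr !mulrDl !mulrDr !(munit_mul eP) !eqxx aa' !eqxx.
  rewrite (negbTE neq_aa') (negbTE neq_a'a) /= !scale0r !scale1r !addr0 !add0r.
  by rewrite scaler_nat mulr2n opprB.
Qed.

(** Different rows are handled by reflections. For equal rows, swaps give all rows of the block the
    same integral, and orthonormality of columns fixes their sum. *)
Lemma Cintegral_coord i j : Cintegral mu (fun u => x u i * (x u j)^*) =
  ((i == j) && (t i.1 == t i.2))%:R / (class_size t i.1)%:R.
Proof.
have Cint0 : Cintegral mu (fun=> 0) = 0 by have [] := Cintegral_cst mu 0.
case: i j => a b [c d] /=; rewrite xpair_eqE; have [<-|ac] /= := eqVneq a c; last first.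
  by rewrite mul0r; exact: Cintegral_coord_diff_row.
have [ab|ab] := eqVneq (t a) (t b); last first.
  rewrite andbF mul0r -[RHS]Cint0; congr (Cintegral mu _); apply/funext => u.
  by rewrite /x mcoef_off // mul0r.
have [ad|ad] := eqVneq (t a) (t d); last first.
  have -> : (b == d) = false by apply: contraNF ad => /eqP <-; rewrite ab.
  rewrite mul0r -[RHS]Cint0; congr (Cintegral mu _); apply/funext => u.
  by rewrite {2}/x mcoef_off // rmorph0 mulr0.
rewrite andbT; have a_gt0 : (class_size t a)%:R != 0 :> R[i].
  rewrite pnatr_eq0 -lt0n; apply/card_gt0P; exists a; exact: eqxx.
apply: (canRL (mulfK a_gt0)).
have [_ <-] := Cintegral_cst mu (b == d)%:R.
have -> : (fun=> (b == d)%:R) =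
    (fun u => \sum_(a' <- enum [pred q | t q == t d]) 1 * (x u (a', b) * (x u (a', d))^*)).
  apply/funext => u; rewrite -(unitary_columns_orthonormal u b d) big_enum.
  by apply: eq_bigr => a' _; rewrite mul1r.
have [_ ->] := Cintegral_lincomb (enum [pred q | t q == t d]) (fun=> 1)
  (fun a' => cintegrable_coord (a', b) (a', d)).
rewrite big_enum /= mulr_natr /class_size -sumr_const.
rewrite [LHS](eq_bigl (fun q => q \in [pred q | t q == t d])); last first.
  by move=> q; rewrite !inE ad.
apply: eq_bigr => a' /[!inE] /eqP ta'; rewrite mul1r.
by apply: Cintegral_coord_swap_row; rewrite ta'.
Qed.

(** Expanding [u] and its adjoint in matrix units leaves integrals of two coordinates; Schur
    orthogonality keeps the diagonal ones. *)
Lemma unitary_averageE xi : unitary_average mu xi =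
  \sum_i (class_size t i.1)%:R^-1 *:
    l2_lmul L (e i) (l2_rmul L xi (star M (e i))).
Proof.
set avg := RHS.
(* Once [avg] is known to satisfy the defining pairings, [xget] returns a vector with the same
   pairings, and these determine it. *)
suff avgP eta : dot L avg eta = Cintegral mu (fun u =>
    dot L (l2_lmul L (val u) (l2_rmul L xi (star M (val u)))) eta).
  have := @xgetPex _ 0 [set zeta : L | forall eta, dot L zeta eta = Cintegral mu
    (fun u => dot L (l2_lmul L (val u) (l2_rmul L xi (star M (val u)))) eta)].
  move=> /(_ (ex_intro _ avg avgP)) xgetP; apply: dot_inj => eta.
  by rewrite avgP -xgetP.
pose g i j := dot L (l2_lmul L (e i) (l2_rmul L xi (star M (e j)))) eta.
have -> : (fun u : unitary D =>
      dot L (l2_lmul L (val u) (l2_rmul L xi (star M (val u)))) eta) =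
    (fun u => \sum_(ij : (I * I) * (I * I)) g ij.1 ij.2 * (x u ij.1 * (x u ij.2)^*)).
  apply/funext => u; have [Du _ _] := unitaryP u.
  rewrite -(mexp_id eP Du) (star_linear_sum e) l2_rmul_sum l2_lmul_sum.
  rewrite dot_lincomb [RHS]sum_pair; apply: eq_bigr => i _.
  rewrite (linear_pred_sum (@l2_lmul_linear _ _ L (e i))).
  under eq_bigr do rewrite (linear_predZ (@l2_lmul_linear _ _ L (e i))).
  rewrite dot_lincomb mulr_sumr; apply: eq_bigr => i' _.
  by rewrite mulrA mulrC.
have [_ ->] := Cintegral_lincomb (index_enum _)
  (fun ij : (I * I) * (I * I) => g ij.1 ij.2)
  (fun ij => cintegrable_coord ij.1 ij.2).
rewrite /avg dot_lincomb [RHS]sum_pair; apply: eq_bigr => i _ /=.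
rewrite (bigD1 i) //= big1 => [|i' /negbTE ii']; last first.
  by rewrite Cintegral_coord eq_sym ii' mul0r mulr0.
rewrite addr0 Cintegral_coord eqxx /= /g.
case: i => p q /=; have [_|pq] := eqVneq (t p) (t q); first by rewrite mul1r mulrC.
by rewrite (munit_off eP pq) l2_lmul0 linear0l mulr0 mul0r.
Qed.

End SchurOrthogonality.

(** * L^2 of a generated von Neumann algebra *)

Section GeneratedL2.
Variables (R : realType) (M : tracialSpace R) (L : l2Space M).

Lemma vn_generated_subalg (S : set M) : unital_subalgebra (vn_generated S).
Proof.
split.
- by move=> C [[[[C1 _ _] _] _] _].
- move=> k x y Sx Sy C CP; have [[[[_ CL _] _] _] _] := CP.
  by apply: CL; [exact: Sx | exact: Sy].
- move=> x y Sx Sy C CP; have [[[[_ _ CM] _] _] _] := CP.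
  by apply: CM; [exact: Sx | exact: Sy].
Qed.

Lemma sub_vn_generated (S : set M) : S `<=` vn_generated S.
Proof. by move=> x Sx C [_ SC]; exact: SC. Qed.

Lemma vn_generated_sub (S T : set M) : S `<=` T -> vn_generated S `<=` vn_generated T.
Proof. by move=> ST x Sx C [vC TC]; apply: Sx; split=> //; exact: subset_trans TC. Qed.

(** Continuous maps carry closures into closures, so only vectors coming from [M] need checking. *)
Lemma l2_generated_image (S T : set M) (f : L -> L) : continuous f ->
  (forall z, vn_generated S z -> exists2 w, vn_generated T w & f (l2_in L z) = l2_in L w) ->
  forall xi, @l2_generated _ _ L S xi -> @l2_generated _ _ L T (f xi).
Proof.
move=> cf fST xi Sxi B fB.
have [_ [[z Sz <-] Bz]] := Sxi _ (cf _ _ fB).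
have [w Tw fE] := fST z Sz.
by exists (f (l2_in L z)); split=> //; exists w.
Qed.

End GeneratedL2.

(** * The liberation gradient over the scalars *)

Section ScalarGradient.
Variables (R : realType) (M : tracialSpace R) (L : l2Space M).

Lemma conditional_expectation_scalars (E : M -> M) x :
  conditional_expectation (scalars M) E -> E x = (trace M x)%:A.
Proof.
move=> [_ ES _ _ tE]; have [c Ec] := ES x.
by rewrite Ec -tE Ec linearZ /= trace1 mulr1.
Qed.

(** Over the scalars the expectation is the trace, so pairing the defining identity with 1 loses
    nothing and makes it numerical. *)
Lemma scalar_gradientE (A1 A2 : set M) (j : L) :
  is_liberation_gradient (scalars M) A1 A2 j ->
  exists2 delta, liberation_derivation (scalars M) A1 A2 delta &
    forall a, alg_join A1 A2 a -> dot L j (l2_in L (star M a)) =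
      \sum_(p <- delta a) trace M p.1 * trace M p.2.
Proof.
move=> [_ _ _ _ [E [Ehat [delta [[EC _ Ec EhatE] dl jE]]]]].
(* Trace preservation extends from [M] to L^2 by density. *)
exists delta => // a Aa; have Ehat1 xi : dot L (Ehat xi) (l2_in L 1) = dot L xi (l2_in L 1).
  move: xi; apply: (@l2_dense_eq _ _ L (R[i])^o).
  - exact: (@norm_hausdorff _ (R[i])^o).
  - exact: continuous_compose Ec (@dot_continuousl _ L _).
  - exact: dot_continuousl.
  - by move=> x; rewrite EhatE !l2_dot star1 !mulr1; case: EC.
rewrite -[star M a]mul1r -l2_dot_rmul -Ehat1 jE // l2_dot star1 mulr1 linear_sum /=.
apply: eq_bigr => p _; rewrite !(conditional_expectation_scalars _ EC).
by rewrite -scalerAl mul1r !linearZ /= trace1 mulr1.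
Qed.

End ScalarGradient.

(** * The averaged gradient over D *)

Section AveragedGradient.
Variables (R : realType) (M : tracialSpace R) (L : l2Space M).
Variables (D A1 A2 : starSubalg M).
Variables (k : nat) (n : 'I_k -> nat) (phi : blockIso D n).
Hypothesis subDA2 : D `<=` A2.

Let e := block_unit phi.
Let eP := block_matrix_units phi.
Let N := (\sum_j n j ^ 2)%N.

Lemma class_size_block (p : bindex n) : class_size (@bindex_tag _ n) p = n (bindex_tag p).
Proof. exact: card_bindex_tag. Qed.

Lemma D_star_subalg : unital_subalgebra D.
Proof. by case: (star_subalgP D). Qed.

Lemma star_munit i : (D : set M) (star M (e i)).
Proof. by case: (star_subalgP D) => _; apply; exact: munit_in eP i. Qed.

Lemma liberation_cV_in : (D : set M) (liberation_c phi)^-1.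
Proof.
rewrite liberation_cV; apply: subalg_sum => [|p]; first exact: D_star_subalg.
by apply: subalgZ D_star_subalg _; exact: munit_in eP _.
Qed.

Definition block_average (xi : L) : L :=
  \sum_i (class_size (@bindex_tag _ n) i.1)%:R^-1 *:
    l2_lmul L (e i) (l2_rmul L xi (star M (e i))).

(** The candidate [j'] with the integral replaced by its finite sum and [dim(D)] by the sum of the
    squared block sizes. *)
Definition averaged_gradient (xi : L) : L :=
  N%:R *: l2_rmul L (block_average xi) (liberation_c phi)^-1.

Lemma averaged_gradient_continuous : continuous averaged_gradient.
Proof.
have avg_c : continuous block_average.
  apply: (@continuous_sum _ L L) => i xi; apply: cvgZl_tmp.
  have := continuous_compose (@l2_rmul_continuous _ _ L (star M (e i)))
    (@l2_lmul_continuous _ _ L (e i)).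
  exact.
move=> xi; apply: cvgZl_tmp.
have := continuous_compose avg_c (@l2_rmul_continuous _ _ L (liberation_c phi)^-1).
exact.
Qed.

Lemma averaged_gradient_in z : averaged_gradient (l2_in L z) = l2_in L (N%:R *:
  ((\sum_i (class_size (@bindex_tag _ n) i.1)%:R^-1 *: (e i * (z * star M (e i)))) *
    (liberation_c phi)^-1)).
Proof.
rewrite linearZ -l2_rmulE linear_sum; congr (_ *: l2_rmul L _ _).
by apply: eq_bigr => i _; rewrite linearZ /= l2_rmulE l2_lmulE.
Qed.

Lemma averaged_gradient_generated xi : @l2_generated _ _ L (A1 `|` A2) xi ->
  @l2_generated _ _ L (alg_join A1 D `|` A2) (averaged_gradient xi).
Proof.
apply: l2_generated_image; first exact: averaged_gradient_continuous.
move=> z Wz; rewrite averaged_gradient_in; eexists; last by [].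
set W := vn_generated _; have sW : unital_subalgebra W by exact: vn_generated_subalg.
have DW : D `<=` W.
  by move=> x Dx; apply: sub_vn_generated; left; exact: alg_join_subr.
have {}Wz : W z.
  apply: vn_generated_sub Wz; apply: setSU; exact: alg_join_subl.
have [_ _ WM] := sW.
apply: (subalgZ _ sW); apply: (WM); last by apply: DW; exact: liberation_cV_in.
apply: (@subalg_sum _ _ W) => // i; apply: (subalgZ _ sW); apply: (WM).
  by apply: DW; exact: munit_in eP i.
by apply: (WM) => //; apply: DW; exact: star_munit.
Qed.

Lemma averaged_gradientE (delta : M -> seq (M * M)) (j : L) :
  liberation_derivation (scalars M) A1 A2 delta ->
  (forall a, alg_join A1 A2 a -> dot L j (l2_in L (star M a)) =
    \sum_(p <- delta a) trace M p.1 * trace M p.2) ->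
  forall a, alg_join A1 A2 a -> l2_mexp e (l2_rmul L (averaged_gradient j) a) =
    l2_in L (\sum_(p <- delta a) mexp e p.1 * mexp e p.2).
Proof.
move=> [dd _ d2] jE a Aa.
have sA := alg_join_subalg A1 A2; have [_ _ AM] := sA.
have DA : D `<=` alg_join A1 A2.
  by apply: (subset_trans subDA2); exact: alg_join_subr.
have dD b : (D : set M) b -> tens_eq (scalars M) (alg_join A1 A2) (delta b) [::].
  by move=> /subDA2; exact: d2.
have sD := D_star_subalg; have [D1 _ DM] := sD.
apply: (@l2_mexp_unique _ _ L _ _ _ _ _ eP).
  by apply: subalg_sum => // p; apply: (DM); exact: mexp_in eP _.
move=> b Db; set c' := (liberation_c phi)^-1.
pose m (i : bindex n * bindex n) : R[i] := (class_size (@bindex_tag _ n) i.1)%:R.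
transitivity (\sum_i (N%:R * (m i)^-1) *
    \sum_(p <- delta a) trace M (star M (e i) * c' * p.1) * trace M (p.2 * (b * e i))).
  rewrite l2_dot_rmul linearZl_LR /= l2_dot_rmul dot_lincomb mulr_sumr.
  apply: eq_bigr => i _; rewrite mulrA l2_dot_lmul l2_dot_rmul starK.
  (* Written as an adjoint, [w] turns the pairing into tau(j d a d') with [d] and [d'] in [D], where
     [delta] vanishes. *)
  congr (_ * _); set w := _ * e i.
  have -> : w = star M (star M (e i) * c' * a * (b * e i)).
    by rewrite /w !starM starK !mulrA.
  have Dei : (D : set M) (e i) := munit_in eP i.
  have Dl : (D : set M) (star M (e i) * c').
    by apply: (DM); [exact: star_munit | exact: liberation_cV_in].
  have Dr : (D : set M) (b * e i) by exact: DM.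
  rewrite jE; last by apply: (AM); [apply: (AM) => //; exact: DA | exact: DA].
  apply: (derivation_eval_bimod sA dd Aa (DA _ Dl) (DA _ Dr) (dD _ Dl) (dD _ Dr)
    (F := fun x y => trace M x * trace M y)).
  - by move=> x x' y; rewrite linearD mulrDl.
  - by move=> x y y'; rewrite linearD mulrDr.
  - move=> x _ y [s ->]; rewrite -scalerAr mulr1 -scalerAl mul1r !linearZ /=.
    by rewrite -mulrA mulrCA.
under eq_bigr do rewrite mulr_sumr.
rewrite exchange_big /= mulr_suml linear_sum /=; apply: eq_bigr => p _.
(* Only the first expectation is expanded, which makes both sides sums over the same units. *)
rewrite {1}[mexp e p.1]/mexp !mulr_suml linear_sum /=; apply: eq_bigr => -[q r] _.
have Der : (D : set M) (b * e (q, r)) by apply: (DM) => //; exact: munit_in eP _.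
(* [b * e (q, r)] lies in [D], so [E_D] can be inserted under the trace. *)
have <- : trace M (e (q, r) * mexp e p.2 * b) = trace M (p.2 * (b * e (q, r))).
  by rewrite -mulrA traceC -mulrA (trace_mexp eP).
rewrite -[in RHS]scalerAl -[in RHS]scalerAl [in RHS]linearZ /= [LHS]mulrA.
congr (_ * _); rewrite /mcoef (munit_star eP) /c' liberation_cV (munit_diag_mull eP).
have -> s y z : trace M (s *: y * z) = s * trace M (z * y).
  by rewrite -scalerAl linearZ /= traceC.
(* The factor [dim(D) / m_q] times [m_q / (dim(D) w_q)] from [c^-1] leaves [1 / w_q], the
   normalisation in [mcoef]. *)
rewrite /m class_size_block /= [LHS]mulrA [RHS]mulrC; congr (_ * _).
have N0 : N%:R != 0 :> R[i] by rewrite pnatr_eq0 -lt0n (block_dim_gt0 phi).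
have n0 := block_size_neq0 phi q.
have w0 := mweight_neq0 eP q.
by rewrite -/N -/e; field; apply/and3P; split.
Qed.

End AveragedGradient.

Unset Implicit Arguments.

Theorem theorem5p8 (R : realType) (M : tracialSpace R) (L : l2Space M)
    (D A1 A2 : starSubalg M)
    (d : nat) (dimD : has_dim D d)
    (k : nat) (n : 'I_k -> nat) (phi : blockIso D n)
    (mu : probability (unitary_borel D L) R) (haar_mu : is_haar mu)
    (free_A : alg_free_mod (scalars M) A1 A2) (subDA2 : D `<=` A2)
    (j : L) (j_def : is_liberation_gradient (scalars M) A1 A2 j) :
  is_liberation_gradient D (alg_join A1 D) A2
    (d%:R *: l2_rmul L (unitary_average mu j) (liberation_c phi)^-1).
Proof.
have eP := block_matrix_units phi.
have sD : unital_subalgebra D by case: (star_subalgP D).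
have scalars_D : scalars M `<=` D.
  by move=> _ [c ->]; apply: subalgZ => //; case: sD.
have [[_ sA2] _ _ j_gen _] := j_def.
have [delta delta_lib delta_j] := scalar_gradientE j_def.
(* [d] and the sum of the squared block sizes both count the index pairs within a block. *)
have -> : d%:R *: l2_rmul L (unitary_average mu j) (liberation_c phi)^-1 =
    averaged_gradient phi j.
  rewrite (unitary_averageE haar_mu eP) /averaged_gradient block_dim.
  by rewrite (has_dim_munit eP dimD).
split.
- by split=> //; exact: alg_join_subalg.
- by split=> //; exact: alg_join_subr.
- exact: alg_free_mod_amalgamate free_A.
- exact: averaged_gradient_generated.
exists (mexp (block_unit phi)), (l2_mexp (block_unit phi)), delta; split.
- exact: (l2_mexp_conditional L eP sD).
- exact: liberation_derivation_amalgamate delta_lib.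
- rewrite alg_join_absorb // => a Aa.
  exact: (averaged_gradientE phi subDA2 delta_lib delta_j Aa).
Qed.
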